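(* There is a randomized (Monte Carlo) algorithm for Path-Contractibility with running time $4^{k+O(\log k)} + n^{O(1)}$, where $n$ is the number of vertices of the input graph $G$. If $G$ is not $k$-contractible to a path, the algorithm outputs no. If $G$ is $k$-contractible to a path, the algorithm outputs yes with probability at least $1-\frac{1}{e}$. Moreover, whenever it outputs yes, it also outputs a $P_\ell$-witness structure of $G$ with $\ell \ge n-k$.
   Context: All graphs are finite, undirected and simple. Contracting an edge $xy$ removes $x$ and $y$ and replaces them by a new vertex adjacent to exactly the vertices adjacent to at least one of $x,y$. A graph $G$ is $k$-contractible to $H$ if $H$ can be obtained from $G$ by at most $k$ edge contractions. Path-Contractibility: given a graph $G$ and integer $k$, decide whether $G$ is $k$-contractible to a path. $P_\ell$ denotes the path $p_1\cdots p_\ell$. A $P_\ell$-witness structure of $G$ is a partition $\{W_1,\dots,W_\ell\}$ of $V(G)$ into nonempty sets, each inducing a connected subgraph, such that for $i\ne j$ there is an edge of $G$ between $W_i$ and $W_j$ if and only if $|i-j|=1$. *)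

(* Defs.v *)
From mathcomp Require Import all_boot all_order all_algebra.
From mathcomp Require Import all_classical all_reals all_analysis.

Set Implicit Arguments.
Unset Strict Implicit.
Unset Printing Implicit Defensive.

Import Order.TTheory GRing.Theory Num.Theory.

Record sgraph := SGraph {
  vertex :> finType;
  adj : rel vertex;
  adj_sym : symmetric adj;
  adj_irrefl : irreflexive adj }.

Definition iso (G H : sgraph) : Prop :=
  exists2 h : G -> H, bijective h & forall u v, adj (h u) (h v) = adj u v.

Section Contraction.
Variables (G : sgraph) (x y : G).

(* [None] is the new vertex; [Some u] is a vertex u other than x and y. *)
Definition contract_vertex : finType := option {v : G | (v != x) && (v != y)}.

Definition contract_adj : rel contract_vertex := fun u v =>
  match u, v with
  | Some u, Some v => adj (val u) (val v)
  | Some u, None => adj x (val u) || adj y (val u)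
  | None, Some v => adj x (val v) || adj y (val v)
  | None, None => false
  end.

Lemma contract_sym : symmetric contract_adj.
Proof. by case=> [u|] [v|] //=; rewrite adj_sym. Qed.

Lemma contract_irrefl : irreflexive contract_adj.
Proof. by case=> [u|] //=; rewrite adj_irrefl. Qed.

Definition contract : sgraph := SGraph contract_sym contract_irrefl.

End Contraction.

Fixpoint contracts (j : nat) (G H : sgraph) : Prop :=
  if j is i.+1 then exists x y : G, adj x y /\ contracts i (contract x y) H
  else iso G H.

Definition contractible (k : nat) (G H : sgraph) : Prop :=
  exists2 j, j <= k & contracts j G H.

Definition path_adj (l : nat) : rel 'I_l :=
  fun i j => (i.+1 == j) || (j.+1 == i).

Lemma path_adj_sym l : symmetric (@path_adj l).
Proof. by move=> i j; rewrite /path_adj orbC. Qed.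

Lemma path_adj_irrefl l : irreflexive (@path_adj l).
Proof. by move=> i; rewrite /path_adj orbb; apply/negbTE; rewrite neq_ltn ltnSn orbT. Qed.

Definition path_graph (l : nat) : sgraph :=
  SGraph (@path_adj_sym l) (@path_adj_irrefl l).

Definition contractible_to_path (k : nat) (G : sgraph) : Prop :=
  exists2 l, 0 < l & contractible k G (path_graph l).

Definition induces_connected (G : sgraph) (A : {set G}) : Prop :=
  {in A &, forall u v,
    connect [rel a b | [&& a \in A, b \in A & adj a b]] u v}.

Definition path_witness (G : sgraph) (l : nat) (W : l.-tuple {set G}) : Prop :=
  [/\ uniq W,
      finset.partition [set:: W] [set: G],
      forall i : 'I_l, induces_connected (tnth W i)
    & forall i j : 'I_l, i != j ->
        (exists u v : G, [/\ u \in tnth W i, v \in tnth W j & adj u v])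
        <-> path_adj i j].

(* Computation model: a first-order functional language on binary trees (the
   language F of N. D. Jones, "Computability and Complexity from a Programming
   Perspective", 1997) extended with a fair coin. [Case e e0 e1] continues with
   e0 if e evaluates to a leaf, and otherwise with e1 with the two subtrees
   pushed onto the environment. Variables are de Bruijn indices, a program is
   the list of the bodies of its mutually recursive one-argument functions, and
   function 0 is the entry point.

   Every construct costs one unit. With trees represented by pointers to shared
   cells each of them takes O(1) instructions on a random access machine or a
   pointer machine, since the size of an environment is bounded by a constant
   depending only on the program. *)

Inductive tree := Leaf | Node of tree & tree.

Inductive exp :=
  | Var of nat
  | Nil
  | Cons of exp & exp
  | Case of exp & exp & exp
  | Let of exp & exp
  | Call of nat & exp
  | Flip.

Definition program := seq exp.

Definition bit_tree (b : bool) : tree := if b then Node Leaf Leaf else Leaf.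

Definition list_tree (s : seq tree) : tree := foldr Node Leaf s.

(* [eval P env e w v w' t]: in environment env, with the coin tosses w still to
   come, e evaluates to v in time t and leaves the tosses w'. A [Flip] with no
   toss left has no value. *)
Inductive eval (P : program) :
    seq tree -> exp -> seq bool -> tree -> seq bool -> nat -> Prop :=
  | eval_Var env i w :
      eval P env (Var i) w (nth Leaf env i) w 1
  | eval_Nil env w :
      eval P env Nil w Leaf w 1
  | eval_Cons env e1 e2 w w1 w2 v1 v2 t1 t2 :
      eval P env e1 w v1 w1 t1 -> eval P env e2 w1 v2 w2 t2 ->
      eval P env (Cons e1 e2) w (Node v1 v2) w2 (t1 + t2).+1
  | eval_Case0 env e e0 e1 w w1 w2 v t1 t2 :
      eval P env e w Leaf w1 t1 -> eval P env e0 w1 v w2 t2 ->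
      eval P env (Case e e0 e1) w v w2 (t1 + t2).+1
  | eval_Case1 env e e0 e1 w w1 w2 a b v t1 t2 :
      eval P env e w (Node a b) w1 t1 ->
      eval P (a :: b :: env) e1 w1 v w2 t2 ->
      eval P env (Case e e0 e1) w v w2 (t1 + t2).+1
  | eval_Let env e1 e2 w w1 w2 u v t1 t2 :
      eval P env e1 w u w1 t1 -> eval P (u :: env) e2 w1 v w2 t2 ->
      eval P env (Let e1 e2) w v w2 (t1 + t2).+1
  | eval_Call env f e w w1 w2 u v t1 t2 :
      eval P env e w u w1 t1 -> eval P [:: u] (nth Nil P f) w1 v w2 t2 ->
      eval P env (Call f e) w v w2 (t1 + t2).+1
  | eval_Flip env b w :
      eval P env Flip (b :: w) (bit_tree b) w 1.

Definition runs (P : program) (x : tree) (w : seq bool) (v : tree) (t : nat) :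
    Prop :=
  exists w', eval P [:: x] (nth Nil P 0) w v w' t.

Lemma eval_det P env e w v1 w1 t1 v2 w2 t2 :
  eval P env e w v1 w1 t1 -> eval P env e w v2 w2 t2 ->
  [/\ v1 = v2, w1 = w2 & t1 = t2].
Proof.
move=> ev; move: v2 w2 t2.
induction ev; intros v3 w3 t3 Hev; inversion Hev; subst; try by split.
all: try clear ev1; try clear ev2; repeat match goal with
  | IH : (forall v w t, eval _ ?s ?e ?w0 v w t -> _), H : eval _ ?s ?e ?w0 _ _ _
    |- _ => destruct (IH _ _ _ H) as [? ? ?]; clear IH; subst
  | H : Node _ _ = Node _ _ |- _ => injection H; clear H; intros; subst
  | H : Leaf = Node _ _ |- _ => discriminate H
  | H : Node _ _ = Leaf |- _ => discriminate H
  end; by split.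
Qed.

Definition coin_prob (R : realType) (m : nat) (E : m.-tuple bool -> Prop) : R :=
  (#|[set w : m.-tuple bool | `[< E w >]]|%:R / 2 ^+ m)%R.

(* Vertices are ordered by [enum]. A graph is given
   by its adjacency matrix, a vertex set by its characteristic vector, and k in
   binary, least significant bit first. *)

Definition vset_tree (G : sgraph) (A : {set G}) : tree :=
  list_tree [seq bit_tree (x \in A) | x <- enum G].

Definition graph_tree (G : sgraph) : tree :=
  list_tree [seq list_tree [seq bit_tree (adj x y) | y <- enum G] | x <- enum G].

Definition nat_tree (k : nat) : tree :=
  list_tree (mkseq (fun i => bit_tree (odd (k %/ 2 ^ i))) (trunc_log 2 k).+1).

Definition instance_tree (G : sgraph) (k : nat) : tree :=
  Node (graph_tree G) (nat_tree k).

Definition answer_no : tree := Leaf.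

Definition answer_yes (G : sgraph) (W : seq {set G}) : tree :=
  Node Leaf (list_tree [seq vset_tree A | A <- W]).

Definition is_yes (v : tree) : bool := if v is Node Leaf _ then true else false.

(* Main.v *)
(* Guessing the bags of a witness structure from left to right gives a
   deterministic algorithm with 3^k n^O(1) steps, so no coin is tossed. The state
   of the search is the current bag B, the known part N of the next bag and the set U
   of unassigned vertices. A vertex of U adjacent to B goes to the current or to
   the next bag, and each of these choices uses up one contraction, unless the
   vertex is the first one of N. The free choice is harmless if B has another
   unassigned neighbour, since then both choices for the latter are not free; this gives
   three branches with smaller budget. It is also harmless if B is disconnected,
   since then it fails at once. If B is connected and has only one unassigned
   neighbour, an exchange argument shows that this vertex may be put into
   the next bag without branching.

   As 3 < 4, no kernel is needed: if q^5 3^k > 4^k then 3^k < q^20, because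
   3^5 <= 4^4, and hence q^5 3^k <= 4^k + q^25. *)

From mathcomp Require Import all_boot zify.
Require Import Defs.

Set Implicit Arguments.
Unset Strict Implicit.
Unset Printing Implicit Defensive.

(** * Contractions and maps with connected fibres *)

Section ConnectedSets.
Variable G : sgraph.
Implicit Types A B C X : {set G}.

Definition nbr A : {set G} := [set u | [exists a in A, adj a u]].

Lemma nbrP A u : reflect (exists2 a, a \in A & adj a u) (u \in nbr A).
Proof. by rewrite inE; apply: (iffP exists_inP). Qed.

(** Phrased by closed subsets instead of paths, so that connectivity of fibres and bags reduces to
    inclusions. The empty set counts as connected; nonemptiness is asked for separately. *)
Definition connected_set A : Prop :=
  forall C, C \subset A -> C != set0 -> nbr C :&: A \subset C -> C = A.

Lemma connected_set1 x : connected_set [set x].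
Proof.
move=> C; rewrite subset1 => /orP[/eqP-> //|/eqP->]; by rewrite eqxx.
Qed.

Lemma induces_connectedP A : induces_connected A <-> connected_set A.
Proof.
split=> [cA C sCA /set0Pn[c cC] /subsetP clC | cA u v uA vA].
  apply/eqP; rewrite eqEsubset sCA; apply/subsetP => a aA.
  have /connectP[p pth ->] := cA c a (subsetP sCA _ cC) aA.
  elim: p c cC pth => //= b p IHp c cC /andP[/and3P[_ bA cb]].
  by apply: IHp; apply: clC; rewrite inE bA andbT; apply/nbrP; exists c.
pose e := [rel a b | [&& a \in A, b \in A & adj a b]].
have /setP/(_ v) : [set w in A | connect e u w] = A.
  apply: cA; first by apply/subsetP=> w; rewrite inE => /andP[].
    by apply/set0Pn; exists u; rewrite inE uA connect0.
  apply/subsetP=> w /setIP[/nbrP[a]]; rewrite !inE => /andP[aA ua] aw wA.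
  by rewrite wA (connect_trans ua) // connect1 //= aA wA.
by rewrite inE vA => /andP[].
Qed.

(** A set rather than a vertex, matching the bit vector that the program computes. *)
Definition low A : {set G} := if enum A is x :: _ then [set x] else set0.

Lemma lowP A : A != set0 -> exists2 x, x \in A & low A = [set x].
Proof.
rewrite /low; case E: (enum A) => [|x s].
  by move: (cardE A); rewrite E => /eqP; rewrite cards_eq0 => /eqP->; rewrite eqxx.
by exists x; rewrite // -mem_enum E mem_head.
Qed.

(** The component of [low A] in [A], grown layer by layer. *)
Definition reach A : {set G} :=
  iter #|G| (fun X => X :|: A :&: nbr X) (low A).

Definition connb A : bool := A :\: reach A == set0.

(** Until the iteration becomes stationary each round adds an element, so after [#|T|] rounds it is
    stationary or has reached the full set. *)
Lemma iter_inflationary_fix (T : finType) (F : {set T} -> {set T}) (X : {set T}) :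
  (forall Y : {set T}, Y \subset F Y) -> F (iter #|T| F X) = iter #|T| F X.
Proof.
move=> infl.
have: F (iter #|T| F X) = iter #|T| F X \/ #|T| <= #|iter #|T| F X|.
  elim: #|T| => [|i [fixi | lei]]; first by right.
    by left; rewrite iterS fixi.
  have [fixi|nfix] := eqVneq (F (iter i F X)) (iter i F X).
    by left; rewrite iterS fixi.
  right; rewrite iterS; apply: leq_ltn_trans lei _; apply: proper_card.
  by rewrite properEneq eq_sym nfix infl.
case=> // le; have ->: iter #|T| F X = setT.
  by apply/eqP; rewrite eqEcard subsetT cardsT.
by apply/eqP; rewrite eqEsubset subsetT infl.
Qed.

(** [reach A] is the least closed subset of [A] containing the first vertex [x]. If it is all of
    [A], a nonempty closed [C] must contain [x]: otherwise [A :\: C], closed by symmetry of [adj],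
    would contain [reach A]. *)
Lemma connbP A : reflect (connected_set A) (connb A).
Proof.
suff [cA Ac] : connb A <-> connected_set A by apply: (iffP idP).
have fixA : reach A :|: A :&: nbr (reach A) = reach A.
  by apply: (@iter_inflationary_fix _ (fun X => X :|: A :&: nbr X)) => Y; apply: subsetUl.
have [->|nzA] := eqVneq A set0.
  split=> [_ C|_]; last by rewrite /connb set0D.
  by rewrite subset0 => /eqP->; rewrite eqxx.
have [x xA lowA] := lowP nzA.
have reachS C : C \subset A -> x \in C -> nbr C :&: A \subset C -> reach A \subset C.
  move=> sCA xC /subsetP clC; rewrite /reach lowA.
  elim: #|G| => [|i IHi] /=; first by rewrite sub1set.
  rewrite subUset IHi; apply/subsetP=> w /setIP[wA /nbrP[a aX aw]].
  apply: clC; rewrite inE wA andbT; apply/nbrP; exists a => //.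
  exact: (subsetP IHi).
have xR : x \in reach A.
  by rewrite /reach lowA; elim: #|G| => [|i IHi] /=; rewrite inE // IHi.
rewrite /connb setD_eq0; split=> [sAR C sCA nzC clC | cA].
  apply/eqP; rewrite eqEsubset sCA /=.
  have [xC|xC] := boolP (x \in C); first exact: subset_trans sAR (reachS C sCA xC clC).
  have [c cC] := set0Pn _ nzC; have cA := subsetP sCA c cC.
  suff /(subset_trans sAR)/subsetP/(_ c cA) : reach A \subset A :\: C.
    by rewrite inE cC.
  apply: reachS; [exact: subsetDl | by rewrite inE xC |].
  apply/subsetP=> w /setIP[/nbrP[a /setDP[aA naC] aw] wA]; rewrite inE wA andbT.
  apply: contra naC => wC; apply: (subsetP clC); rewrite inE aA andbT.
  by apply/nbrP; exists w; rewrite // adj_sym.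
have sRA : reach A \subset A.
  apply: reachS => //; exact: subsetIr.
rewrite (cA (reach A)) //; first by apply/set0Pn; exists x.
by rewrite setIC -{2}fixA subsetUr.
Qed.

End ConnectedSets.

(** * Contraction sequences as surjections with connected fibres *)

Section Models.

(** All contractions from [G] to [H] at once: [phi] sends each vertex to the one it is merged into,
    and its fibres are the witness sets. *)
Definition model (G H : sgraph) (phi : G -> H) : Prop :=
  [/\ forall a, exists u, phi u = a,
      forall a, connected_set [set u | phi u == a]
    & forall a b, a != b ->
        adj a b <-> exists u v, [/\ phi u = a, phi v = b & adj u v]].

(** For the connectivity of a composite fibre: a closed [C] is a union of fibres of [phi], and its
    image is closed in a fibre of [psi], hence is that whole fibre. *)
Lemma model_comp (G K H : sgraph) (phi : G -> K) (psi : K -> H) :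
  model phi -> model psi -> model (psi \o phi).
Proof.
move=> [sphi cphi ephi] [spsi cpsi epsi]; split=> [a|a|a b nab].
- by have [b <-] := spsi a; have [u <-] := sphi b; exists u.
- move=> C sC nzC clC.
  have full u v : u \in C -> phi u = phi v -> v \in C.
    move=> uC uv; suff /setP/(_ v): C :&: [set w | phi w == phi v] = [set w | phi w == phi v].
      by rewrite !inE eqxx andbT.
    apply: cphi; [exact: subsetIr | by apply/set0Pn; exists u; rewrite !inE uC uv /= |].
    apply/subsetP=> w /setIP[/nbrP[c /setIP[cC]]].
    rewrite !inE => /eqP cv cw wv; rewrite wv andbT.
    apply: (subsetP clC); rewrite !inE /= (eqP wv) -cv.
    move/(subsetP sC): (cC); rewrite inE /= => ->; rewrite andbT.
    by apply/exists_inP; exists c.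
  have imC : phi @: C = [set b | psi b == a].
    apply: cpsi.
    + by apply/subsetP=> b /imsetP[u uC ->]; move/(subsetP sC): uC; rewrite !inE.
    + by have [u uC] := set0Pn _ nzC; apply/set0Pn; exists (phi u); apply: imset_f.
    + apply/subsetP=> b /setIP[/nbrP[c /imsetP[u uC ->] ub] pb].
      have nub : phi u != b by apply: contraTneq ub => ->; rewrite adj_irrefl.
      have [u1 [v1 [e1 e2 uv]]] := (ephi _ _ nub).1 ub.
      apply/imsetP; exists v1; last by [].
      apply: (subsetP clC); rewrite !inE /= e2; rewrite inE in pb; rewrite pb andbT.
      by apply/exists_inP; exists u1 => //; apply: full uC _.
  apply/setP=> v; apply/idP/idP => [/(subsetP sC) //|]; rewrite inE /= => va.
  have: phi v \in phi @: C by rewrite imC inE.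
  by case/imsetP=> u uC vu; apply: full uC _.
- split=> [/(epsi _ _ nab).1 [p [q [pa qb pq]]]|[u [v [ua vb uv]]]].
    have npq : p != q by apply: contraTneq pq => ->; rewrite adj_irrefl.
    have [u [v [up vq uv]]] := (ephi _ _ npq).1 pq.
    by exists u, v; rewrite /= up vq.
  apply/(epsi _ _ nab); exists (phi u), (phi v); split=> //.
  apply/ephi; last by exists u, v.
  by apply: contra nab => /eqP uv'; rewrite -ua -vb /= uv'.
Qed.

(** Splits a first contraction off from a given model. Connectivity passes to [psi] because
    preimages of closed sets under [phi] are closed. *)
Lemma model_factor (G K H : sgraph) (phi : G -> K) (psi : K -> H) :
  model phi -> model (psi \o phi) -> model psi.
Proof.
move=> [sphi cphi ephi] [sc cc ec]; split=> [a|a|a b nab].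
- by have [u <-] := sc a; exists (phi u).
- move=> C sC nzC clC.
  have preC : phi @^-1: C = [set u | (psi \o phi) u == a].
    apply: cc.
    + by apply/subsetP=> u; rewrite !inE => uC; have := subsetP sC _ uC; rewrite inE.
    + have [b bC] := set0Pn _ nzC; have [u ub] := sphi b.
      by apply/set0Pn; exists u; rewrite inE ub.
    + apply/subsetP=> v /setIP[/nbrP[u]]; rewrite [u \in _]inE => uC uv.
      rewrite !inE /= => va; have [<- //|nuv] := eqVneq (phi u) (phi v).
      apply: (subsetP clC); apply/setIP; split; last by rewrite inE.
      by apply/nbrP; exists (phi u) => //; apply/ephi => //; exists u, v.
  apply/setP=> b; have [u <-] := sphi b.
  by move/setP/(_ u): preC; rewrite !inE.
- split=> [/(ec _ _ nab).1 [u [v [ua vb uv]]]|[p [q [pa qb pq]]]].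
    exists (phi u), (phi v); split=> //; apply/ephi; last by exists u, v.
    by apply: contra nab => /eqP uv'; rewrite -ua -vb /= uv'.
  have npq : p != q by apply: contraTneq pq => ->; rewrite adj_irrefl.
  have [u [v [up vq uv]]] := (ephi _ _ npq).1 pq.
  by apply/(ec _ _ nab); exists u, v; rewrite /= up vq.
Qed.

Lemma iso_model (G H : sgraph) : iso G H -> exists phi : G -> H, model phi.
Proof.
case=> h [g hg gh] eh; exists h; split=> [a|a|a b nab].
- by exists (g a).
- have ->: [set u | h u == a] = [set g a].
    by apply/setP=> u; rewrite !inE (can2_eq hg gh).
  exact: connected_set1.
- split=> [ab|[u [v [<- <- uv]]]]; last by rewrite eh.
  by exists (g a), (g b); rewrite -eh !gh.
Qed.

Lemma injective_model_iso (G H : sgraph) (phi : G -> H) :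
  injective phi -> model phi -> iso G H.
Proof.
move=> inj [sphi _ ephi]; exists phi.
  have sphi' : forall a, exists u, phi u == a.
    by move=> a; have [u <-] := sphi a; exists u.
  exists (fun a => xchoose (sphi' a)) => u; last exact/eqP/(xchooseP (sphi' u)).
  by apply: inj; apply/eqP/(xchooseP (sphi' (phi u))).
move=> u v; have [->|nuv] := eqVneq u v; first by rewrite !adj_irrefl.
have nphi : phi u != phi v by rewrite (inj_eq inj).
apply/idP/idP => [/(ephi _ _ nphi).1 [u' [v' [/inj -> /inj -> //]]]|uv].
by apply/(ephi _ _ nphi); exists u, v.
Qed.

Section Contract.
Variables (G : sgraph) (x y : G).

Definition contract_map (u : G) : contract x y := insub u.

Lemma contract_map_None u : (contract_map u == None) = (u == x) || (u == y).
Proof.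
rewrite /contract_map; case: insubP => [v /andP[nx ny] _|].
  by rewrite (negbTE nx) (negbTE ny).
by rewrite negb_and !negbK => ->.
Qed.

Lemma contract_map_val (v : {v : G | (v != x) && (v != y)}) :
  contract_map (val v) = Some v.
Proof. by rewrite /contract_map valK. Qed.

Lemma contract_map_Some u v : contract_map u = Some v -> u = val v.
Proof. by rewrite /contract_map; case: insubP => // w _ <- [->]. Qed.

Hypothesis xy : adj x y.

Lemma contract_neq : x != y.
Proof. by apply: contraTneq xy => ->; rewrite adj_irrefl. Qed.

Lemma contract_map_model : model contract_map.
Proof.
have qx : contract_map x = None by apply/eqP; rewrite contract_map_None eqxx.
have qy : contract_map y = None by apply/eqP; rewrite contract_map_None eqxx orbT.
split=> [[v|]|[v|]|].
- by exists (val v); rewrite contract_map_val.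
- by exists x.
- have ->: [set u | contract_map u == Some v] = [set val v].
    apply/setP=> u; rewrite !inE; apply/eqP/eqP => [/contract_map_Some //|->].
    exact: contract_map_val.
  exact: connected_set1.
- move=> C sC nzC /subsetP clC; apply/eqP; rewrite eqEsubset sC /=.
  have xyC : (x \in C) = (y \in C).
    apply/idP/idP => zC; apply: clC; rewrite !inE ?qx ?qy eqxx andbT;
      apply/exists_inP; [exists x | exists y] => //; by rewrite adj_sym.
  have [z zC] := set0Pn _ nzC.
  have xC : x \in C.
    have := subsetP sC z zC; rewrite inE contract_map_None => /orP[/eqP <- //|/eqP zy].
    by rewrite xyC -zy.
  apply/subsetP=> u; rewrite inE contract_map_None => /orP[/eqP-> //|/eqP->].
  by rewrite -xyC.
- move=> [a|] [b|] //= nab; split.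
  + by move=> ab; exists (val a), (val b); rewrite !contract_map_val.
  + by case=> u [v [/contract_map_Some -> /contract_map_Some ->]].
  + by case/orP=> h; [exists (val a), x | exists (val a), y]; rewrite contract_map_val adj_sym.
  + case=> u [v [/contract_map_Some -> /eqP]].
    by rewrite contract_map_None => /orP[] /eqP-> ; rewrite adj_sym => ->; rewrite ?orbT.
  + by case/orP=> h; [exists x, (val b) | exists y, (val b)]; rewrite contract_map_val.
  + case=> u [v [/eqP + /contract_map_Some ->]].
    by rewrite contract_map_None => /orP[] /eqP-> ->; rewrite ?orbT.
Qed.

Lemma card_contract : #|G| = #|contract x y|.+1.
Proof.
rewrite /= card_option card_sig.
have ->: #|[pred v : G | (v != x) && (v != y)]| = #|~: [set x; y]|.
  by apply: eq_card => v; rewrite !inE negb_or.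
by rewrite -(cardsC [set x; y]) cards2 contract_neq.
Qed.

End Contract.

Lemma contracts_model j (G H : sgraph) :
  contracts j G H -> exists2 phi : G -> H, model phi & #|G| = #|H| + j.
Proof.
elim: j G => [|j IHj] G /=.
  move=> isoGH; have [h bij _] := isoGH; have [phi mphi] := iso_model isoGH.
  by exists phi; rewrite // addn0 (bij_eq_card bij).
case=> x [y [xy /IHj[psi mpsi card]]].
exists (psi \o @contract_map G x y); first exact: model_comp (contract_map_model xy) mpsi.
by rewrite addnS -card; apply: card_contract.
Qed.

Lemma model_card (G H : sgraph) (phi : G -> H) :
  model phi -> #|H| <= #|G| ?= iff injectiveb phi.
Proof.
case=> sphi _ _.
have -> : #|H| = #|[set phi u | u in G]|.
  rewrite -cardsT; apply: eq_card => a; rewrite inE; apply/esym/imsetP.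
  by have [u <-] := sphi a; exists u.
have -> : injectiveb phi = dinjectiveb phi G by [].
split; first exact: leq_imset_card.
by apply/imset_injP/dinjectiveP.
Qed.

(** Induction on the number of excess vertices: a map that is not injective has a fibre with an edge
    inside, and factors through the contraction of that edge. *)
Lemma model_contracts j (G H : sgraph) (phi : G -> H) :
  model phi -> #|G| = #|H| + j -> contracts j G H.
Proof.
elim: j G phi => [|j IHj] G phi mphi card /=.
  apply: (injective_model_iso _ mphi); apply/injectiveP.
  by rewrite -(geq_leqif (model_card mphi)) card addn0.
have /injectivePn[x [z nxz xz]] : ~~ injectiveb phi.
  by rewrite -(geq_leqif (model_card mphi)) card addnS -ltnNge ltnS leq_addr.
have [_ cphi _] := mphi.
(* Otherwise [[set x]] would be closed in its fibre, which also contains [z]. *)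
have [y /andP[/eqP xyphi xy]] : exists y, (phi x == phi y) && adj x y.
  apply/existsP; apply: contraT => /existsPn none.
  have /setP/(_ z) : [set x] = [set u | phi u == phi x].
    apply: cphi; first by rewrite sub1set inE.
      by apply/set0Pn; exists x; rewrite inE.
    apply/subsetP=> y /setIP[/nbrP[? /set1P-> xy]]; rewrite inE => yx.
    by have := none y; rewrite eq_sym yx xy.
  by rewrite !inE -xz eqxx eq_sym (negbTE nxz).
exists x, y; split=> //.
pose psi (p : contract x y) := if p is Some v then phi (val v) else phi x.
have psiE : psi \o @contract_map G x y =1 phi.
  move=> u /=; case E: (contract_map x y u) => [v|] /=.
    by rewrite (contract_map_Some E).
  by move/eqP: E; rewrite contract_map_None => /orP[] /eqP->.
apply: (IHj _ psi).
  apply: model_factor (contract_map_model xy) _.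
  have [s c e] := mphi; split=> [a|a|a b nab].
  - by have [u <-] := s a; exists u; apply: psiE.
  - have -> : [set u | (psi \o contract_map x y) u == a] = [set u | phi u == a].
      by apply/setP=> u; rewrite !inE psiE.
    exact: c.
  - split=> [/(e _ _ nab).1|] [u [v [ua vb uv]]].
      by exists u, v; rewrite !psiE.
    by apply/(e _ _ nab); exists u, v; rewrite -!psiE.
by apply/eqP; rewrite -eqSS -(card_contract xy) card addnS.
Qed.

End Models.

(** * Witness structures as lists of bags *)

Section BagPaths.
Variable G : sgraph.
Implicit Types (A B N U X W : {set G}) (s : seq {set G}).

(* The P_l-witness structures of the subgraph induced by X, as lists of bags. *)
Fixpoint bag_path X s : Prop :=
  if s is W :: s' then
    [/\ (W != set0) && (W \subset X), connected_set W,
        nbr W :&: (X :\: W) \subset head set0 s',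
        (s' == [::]) || (nbr W :&: head set0 s' != set0)
      & bag_path (X :\: W) s']
  else X = set0.

Lemma nbrS A B : A \subset B -> nbr A \subset nbr B.
Proof.
move=> sAB; apply/subsetP=> u /nbrP[a aA au]; apply/nbrP.
by exists a; rewrite // (subsetP sAB).
Qed.

Lemma bag_path_mem X s W :
  bag_path X s -> W \in s -> [/\ W != set0, W \subset X & connected_set W].
Proof.
elim: s X => // V s IHs X [/andP[nzV sVX] cV _ _ /IHs{}IHs].
rewrite inE => /orP[/eqP-> //|/IHs[nzW sW cW]]; split=> //.
exact: subset_trans sW (subsetDl _ _).
Qed.

Lemma head_bag_subset X s : bag_path X s -> head set0 s \subset X.
Proof. by case: s => [_|W s [/andP[]]] //; rewrite sub0set. Qed.

Lemma bag_path_disjoint X s :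
  bag_path X s -> pairwise (fun A B : {set G} => [disjoint A & B]) s.
Proof.
elim: s X => //= V s IHs X [_ _ _ _ bp]; rewrite (IHs _ bp) andbT.
apply/allP=> W /(bag_path_mem bp)[_ sW _].
by rewrite disjoint_sym disjoints_subset (subset_trans sW) // setDE subsetIr.
Qed.

Lemma bag_path_cover X s u : bag_path X s -> u \in X -> exists2 W, W \in s & u \in W.
Proof.
elim: s X => [X ->|V s IHs X [_ _ _ _ bp] uX]; first by rewrite inE.
have [uV|uV] := boolP (u \in V); first by exists V; rewrite ?mem_head.
have [|W Ws uW] := IHs _ bp; first by rewrite inE uV.
by exists W; rewrite // inE Ws orbT.
Qed.

Lemma bag_path_edge X s i j u v :
  bag_path X s -> i < j -> u \in nth set0 s i -> v \in nth set0 s j -> adj u v ->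
  j = i.+1.
Proof.
elim: s X i j => [|V s IHs] X i j; first by rewrite !nth_nil inE.
case=> [_ _ /subsetP edge _ bp]; case: j => // j; case: i => [_|i lt] /=; last first.
  by move=> ui vj uv; rewrite (IHs _ i j bp lt ui vj uv).
move=> uV vj uv; have [js|js] := ltnP j (size s); last by rewrite nth_default ?inE in vj.
have [_ /subsetP sj _] := bag_path_mem bp (mem_nth set0 js).
have vh : v \in head set0 s.
  by apply: edge; rewrite inE sj // andbT; apply/nbrP; exists u.
case: j vj js {sj} => // j vj js; exfalso.
have /(pairwiseP set0)/(_ 0 j.+1) := bag_path_disjoint bp.
have s0 : 0 < size s by apply: leq_ltn_trans js.
move=> /(_ s0 js isT); rewrite nth0 => /disjoint_setI0/setP/(_ v).
by rewrite !inE vh vj.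
Qed.

Lemma bag_path_adjacent X s i :
  bag_path X s -> i.+1 < size s ->
  exists u v, [/\ u \in nth set0 s i, v \in nth set0 s i.+1 & adj u v].
Proof.
elim: s X i => //= V s IHs X i [_ _ _ adjV bp]; rewrite ltnS => lt.
case: i lt => [|i] lt; last exact: IHs bp lt.
have nzs : s != [::] by case: (s) lt.
rewrite (negbTE nzs) /= in adjV; have [v /setIP[/nbrP[u uV uv] vh]] := set0Pn _ adjV.
by exists u, v; rewrite /= nth0.
Qed.

Lemma bag_path_witness s : bag_path [set: G] s -> path_witness (in_tuple s).
Proof.
move=> bp; have disj := bag_path_disjoint bp.
have /(pairwiseP set0) nthD := disj.
split.
- rewrite uniq_pairwise; apply: (@sub_in_pairwise _ (mem s)) disj; last exact/allP.
  move=> A B As Bs; apply: contraL => /eqP <-; rewrite -setI_eq0 setIid.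
  by have [] := bag_path_mem bp As.
- apply/and3P; split.
  + rewrite eqEsubset subsetT; apply/subsetP=> u uT.
    by have [W Ws uW] := bag_path_cover bp uT; apply/bigcupP; exists W; rewrite ?inE.
  + apply/trivIsetP=> A B; rewrite !inE => /(nthP set0)[i iS <-] /(nthP set0)[j jS <-].
    have [lt|lt|->] := ltngtP i j; last by rewrite eqxx.
      by move=> _; apply: nthD.
    by move=> _; rewrite disjoint_sym; apply: nthD.
  + by rewrite inE; apply/negP=> /(bag_path_mem bp)[]; rewrite eqxx.
- move=> i; apply/induces_connectedP; rewrite (tnth_nth set0) /=.
  by have [] := bag_path_mem bp (mem_nth set0 (ltn_ord i)).
- move=> i j nij; rewrite !(tnth_nth set0) /= /path_adj; split.
    case=> u [v [ui vj uv]]; have [lt|lt|/val_inj eij] := ltngtP i j.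
    + by rewrite (bag_path_edge bp lt ui vj uv) eqxx.
    + by rewrite adj_sym in uv; rewrite (bag_path_edge bp lt vj ui uv) eqxx orbT.
    + by rewrite eij eqxx in nij.
  case/orP=> /eqP eij.
    by rewrite -eij; apply: (bag_path_adjacent bp); rewrite eij.
  have [|u [v [ui vj uv]]] := @bag_path_adjacent _ _ j bp; first by rewrite eij.
  by exists v, u; rewrite -eij adj_sym.
Qed.

Lemma path_witness_model l (W : l.-tuple {set G}) :
  path_witness W -> exists phi : G -> path_graph l, model phi.
Proof.
case=> uniqW /and3P[/eqP covW /trivIsetP disj nz] conW edgeW.
have nzW i : exists u, u \in tnth W i.
  by apply/set0Pn; apply: contraNneq nz => <-; rewrite inE mem_tnth.
have disjW i j u : u \in tnth W i -> u \in tnth W j -> i = j.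
  move=> ui uj; apply/eqP; rewrite -(inj_eq (elimT (tuple_uniqP W) uniqW)); apply: contraT => nij.
  have /disjoint_setI0/setP/(_ u) : [disjoint tnth W i & tnth W j].
    by apply: disj nij; rewrite inE mem_tnth.
  by rewrite !inE ui uj.
have [phi phiP] : exists phi : G -> 'I_l, forall u, u \in tnth W (phi u).
  apply: (@fin_all_exists G (fun=> 'I_l) (fun u i => u \in tnth W i)) => u.
  have: u \in cover [set:: W] by rewrite covW inE.
  by case/bigcupP=> A; rewrite inE => /tnthP[i ->] ui; exists i.
have fibre i : [set u | phi u == i] = tnth W i.
  by apply/setP=> u; rewrite inE; apply/eqP/idP => [<- //|]; apply: disjW.
exists phi; split=> [i|i|i j nij].
- by have [u ui] := nzW i; exists u; apply: disjW ui.
- by rewrite fibre; apply/induces_connectedP.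
- have -> : adj i j = path_adj i j by [].
  rewrite -edgeW //; split=> -[u [v [ui vj uv]]]; exists u, v; split=> //.
  + exact: disjW ui.
  + exact: disjW vj.
  + by rewrite -ui.
  + by rewrite -vj.
Qed.

Lemma model_bag_path l (phi : G -> path_graph l) :
  model phi -> exists2 s, bag_path [set: G] s & size s = l.
Proof.
case=> surj con edge.
(* The induction runs over the fibres from [i] on, whose union is what remains of [G] after the
   first [i] bags. *)
suff bp d i : i + d = l ->
  bag_path [set u | i <= phi u] [seq [set u | phi u == j :> nat] | j <- iota i d].
  exists [seq [set u | phi u == j :> nat] | j <- iota 0 l]; last by rewrite size_map size_iota.
  by rewrite (_ : setT = [set u | 0 <= phi u]); [exact: bp | apply/setP=> u; rewrite !inE].
elim: d i => [|d IHd] i il /=.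
  by apply/setP=> u; rewrite !inE -(addn0 i) il leqNgt ltn_ord.
have li : i < l by lia.
pose p : path_graph l := Ordinal li.
have fibre : [set u | phi u == i :> nat] = [set u | phi u == p].
  by apply/setP=> u; rewrite !inE; apply/eqP/eqP => [->|] //; apply: ord_inj.
have [u ui] := surj (Ordinal li).
have eqD : [set u | i <= phi u] :\: [set u | phi u == i :> nat] = [set u | i.+1 <= phi u].
  by apply/setP=> w; rewrite !inE ltn_neqAle eq_sym.
split.
- apply/andP; split; first by apply/set0Pn; exists u; rewrite inE ui.
  by apply/subsetP=> w; rewrite !inE => /eqP->.
- rewrite fibre; exact: con.
- rewrite eqD; apply/subsetP=> w /setIP[/nbrP[a]]; rewrite !inE => /eqP ai aw iw.
  have naw : phi a != phi w by apply: contraTneq iw => <-; rewrite ai ltnn.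
  have : path_adj (phi a) (phi w) by apply/(edge _ _ naw); exists a, w.
  case/orP=> /eqP; rewrite ai => ew; last by lia.
  have := ltn_ord (phi w); case: (d) il => [|d'] il /=; first by lia.
  by rewrite inE -ew eqxx.
- case: d IHd il => [|d] IHd il //=.
  have li1 : i.+1 < l by lia.
  pose q : path_graph l := Ordinal li1.
  have nij : p != q by apply/eqP => -[]; lia.
  have [|a [b [ai bi ab]]] := (edge _ _ nij).1; first by rewrite /= /path_adj /= eqxx.
  apply/set0Pn; exists b; rewrite !inE bi eqxx andbT; apply/exists_inP.
  by exists a; rewrite // inE ai.
- by rewrite eqD; apply: IHd; lia.
Qed.

Lemma contractible_bag_path k :
  contractible_to_path k G ->
  exists s, [/\ bag_path [set: G] s, 0 < size s & #|G| <= k + size s].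
Proof.
case=> l l0 [j jk /contracts_model[phi mphi card]].
have [s bp sz] := model_bag_path mphi; exists s.
by rewrite sz card card_ord addnC leq_add2r.
Qed.

Lemma bag_path_size X W s : bag_path X (W :: s) -> #|W| + size s <= #|X|.
Proof.
elim: s X W => [|V s IHs] X W [/andP[_ sWX] _ _ _ bp].
  by rewrite addn0 subset_leq_card.
have := IHs _ _ bp; have [/andP[nzV _] _ _ _ _] := bp.
rewrite cardsD (setIidPr sWX) /=; move: nzV; rewrite -card_gt0.
by have := subset_leq_card sWX; lia.
Qed.

(** The empty graph has the empty list of bags, whereas a path needs a vertex; hence the first
    hypothesis. *)
Lemma bag_path_contractible k s :
  0 < #|G| -> bag_path [set: G] s -> #|G| <= k + size s -> contractible_to_path k G.
Proof.
move=> G0 bp le; have [phi mphi] := path_witness_model (bag_path_witness bp).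
have le2 : 0 < size s <= #|G|.
  case: s bp {le phi mphi} => [/= T0|W s bp].
    by rewrite -cardsT T0 cards0 in G0.
  have := bag_path_size bp; have [/andP[nzW _] _ _ _ _] := bp.
  by move: nzW; rewrite -card_gt0 cardsT /=; lia.
exists (size s); first by case/andP: le2.
exists (#|G| - size s); first by lia.
by apply: (model_contracts mphi); rewrite card_ord; lia.
Qed.

End BagPaths.

(** * The branching search *)

Section Search.
Variable G : sgraph.
Implicit Types (A B N U X W : {set G}) (s : seq {set G}).

(* The budget k bounds the number of vertices of U that do not open a new bag;
   h is fuel. *)
Fixpoint search h U B N k : option (seq {set G}) :=
  if h isn't h'.+1 then None else
  let F := U :&: nbr B in
  let v := low F in
  if F == set0 then
    if ~~ connb B then None
    else if N == set0 then if U == set0 then Some [:: B] else None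
    else omap (cons B) (search h' U N set0 k)
  else
    let r :=
      if [&& N == set0, F :\: v == set0 & connb B] then None
      else if k is k'.+1 then search h' (U :\: v) (B :|: v) N k' else None in
    if r is Some s then Some s
    else if (if N == set0 then k.+1 else k) is k'.+1
    then search h' (U :\: v) B (N :|: v) k' else None.

(** Invariant of [search]. Vertices enter [N] only as neighbours of [B], which later yields the edge
    between the two bags. *)
Definition state_ok U B N : bool :=
  [&& B != set0, N \subset nbr B, [disjoint U & B], [disjoint U & N]
    & [disjoint B & N]].

(** Apart from the bags of [B] and of a nonempty [N], each bag of [s] is opened by one vertex of
    [U]. The last clause says that at most [k] vertices of [U] open no bag. *)
Definition completes U B N k s : Prop :=
  [/\ bag_path (U :|: B :|: N) s, B \subset head set0 s,
      N \subset head set0 (behead s)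
    & #|U| + 1 + (N != set0) <= k + size s].

Lemma state_ok_shift U B N : state_ok U B N -> N != set0 -> state_ok U N set0.
Proof.
case/and5P=> _ _ _ dUN _ nzN; apply/and5P; split=> //; first exact: sub0set.
all: by rewrite disjoint_sym disjoints_subset sub0set.
Qed.

Lemma state_ok_join U B N v :
  state_ok U B N -> v \in U -> state_ok (U :\ v) (B :|: [set v]) N.
Proof.
case/and5P=> nzB sN dUB dUN dBN vU; apply/and5P; split.
- by apply/set0Pn; exists v; rewrite !inE eqxx orbT.
- exact: subset_trans sN (nbrS (subsetUl _ _)).
- rewrite -setI_eq0; apply/eqP/setP=> u; rewrite !inE.
  by have [-> //|_] := eqVneq u v; rewrite orbF; case: (boolP (u \in U)) => // uU;
    rewrite (disjointFr dUB uU).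
- by apply: disjointWl dUN; apply: subsetDl.
- rewrite -setI_eq0; apply/eqP/setP=> u; rewrite !inE.
  have [->|_] := eqVneq u v; first by rewrite (disjointFr dUN vU) andbF.
  by rewrite orbF; case: (boolP (u \in B)) => // uB; rewrite (disjointFr dBN uB).
Qed.

Lemma state_ok_next U B N v :
  state_ok U B N -> v \in U :&: nbr B -> state_ok (U :\ v) B (N :|: [set v]).
Proof.
case/and5P=> nzB sN dUB dUN dBN /setIP[vU vB]; apply/and5P; split=> //.
- by rewrite subUset sN sub1set.
- by apply: disjointWl dUB; apply: subsetDl.
- rewrite -setI_eq0; apply/eqP/setP=> u; rewrite !inE.
  have [-> //|_] := eqVneq u v; rewrite orbF.
  by case: (boolP (u \in U)) => // uU; rewrite (disjointFr dUN uU).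
- rewrite -setI_eq0; apply/eqP/setP=> u; rewrite !inE.
  have [->|_] := eqVneq u v; first by rewrite (disjointFr dUB vU).
  by rewrite orbF; case: (boolP (u \in B)) => // uB; rewrite (disjointFr dBN uB).
Qed.

Lemma setU_join U B N v :
  v \in U -> (U :\ v) :|: (B :|: [set v]) :|: N = U :|: B :|: N.
Proof.
move=> vU; apply/setP=> u; rewrite !inE.
by have [->|] := eqVneq u v; rewrite ?vU ?orbT ?orbF.
Qed.

Lemma setU_next U B N v :
  v \in U -> (U :\ v) :|: B :|: (N :|: [set v]) = U :|: B :|: N.
Proof.
move=> vU; apply/setP=> u; rewrite !inE.
by have [->|] := eqVneq u v; rewrite ?vU ?orbT ?orbF.
Qed.

Lemma setU1_neq0 N v : N :|: [set v] != set0.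
Proof. by apply/set0Pn; exists v; rewrite !inE eqxx orbT. Qed.

Lemma completes_join U B N k s v : v \in U ->
  completes (U :\ v) (B :|: [set v]) N k s -> completes U B N k.+1 s.
Proof.
move=> vU [bp hB hN le]; split=> //; first by rewrite setU_join in bp.
  exact: subset_trans (subsetUl _ _) hB.
by move: le; rewrite (cardsD1 v U) vU; clear; lia.
Qed.

(** The vertex that makes [N] nonempty opens a bag and so is free of charge. *)
Lemma completes_next U B N k s v : v \in U ->
  completes (U :\ v) B (N :|: [set v]) k s ->
  completes U B N (if N == set0 then k else k.+1) s.
Proof.
move=> vU [bp hB hN le]; split=> //; first by rewrite setU_next in bp.
  exact: subset_trans (subsetUl _ _) hN.
move: le; rewrite setU1_neq0 (cardsD1 v U) vU.
by case: eqP => _ /=; lia.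
Qed.

Lemma search_sound h U B N k s :
  state_ok U B N -> search h U B N k = Some s -> completes U B N k s.
Proof.
elim: h U B N k s => // h IHh U B N k s ok /=.
have /and5P[nzB sN dUB dUN dBN] := ok.
have [F0|/lowP[v vF ->]] := eqVneq (U :&: nbr B) set0; last first.
  have vU : v \in U by case/setIP: vF.
  pose r := if [&& N == set0, (U :&: nbr B) :\ v == set0 & connb B] then None
      else if k is k'.+1 then search h (U :\ v) (B :|: [set v]) N k' else None.
  rewrite -/r; case E: r => [s'|] => [[<-]|].
    move: E; rewrite /r; case: ifP => // _; case: k {r} => // k E.
    exact/(completes_join vU)/(IHh _ _ _ _ _ (state_ok_join ok vU) E).
  have next k' : search h (U :\ v) B (N :|: [set v]) k' = Some s ->
    completes U B N (if N == set0 then k' else k'.+1) s.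
    by move=> E'; apply/(completes_next vU)/(IHh _ _ _ _ _ (state_ok_next ok vF) E').
  by case: eqP next => _ next; [apply: next | case: k {r E} => // k; apply: next].
case: connbP => //= cB; case: eqP => [N0|/eqP nzN].
  case: eqP => // U0 [<-]; split.
  - rewrite /= U0 N0 set0U setU0; by split; rewrite ?nzB ?setDv ?setI0 ?sub0set ?subxx.
  - exact: subxx.
  - by rewrite N0 sub0set.
  - by rewrite U0 N0 cards0 eqxx /=; lia.
(* [B] becomes a finished bag. By [F0] its remaining neighbours lie in [N], and [N \subset nbr B]
   gives the edge to the next bag. *)
case E: (search h U N set0 k) => [s'|] //= [<-].
have [bp hN _ le] := IHh _ _ _ _ _ (state_ok_shift ok nzN) E.
have XB : (U :|: B :|: N) :\: B = U :|: N.
  apply/setP=> u; rewrite !inE; case: (boolP (u \in B)) => uB /=; last by rewrite orbF.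
  by rewrite (disjointFl dUB uB) (disjointFr dBN uB).
split=> //.
- split; rewrite ?XB.
  + by rewrite nzB -setUA setUCA subsetUl.
  + exact: cB.
  + apply: subset_trans hN; apply/subsetP=> u; rewrite !inE => /andP[uB /orP[uU|//]].
    by move/setP/(_ u): F0; rewrite !inE uU uB.
  + apply/orP; right; have [u uN] := set0Pn _ nzN.
    by apply/set0Pn; exists u; rewrite inE (subsetP sN) // (subsetP hN).
  + by rewrite setU0 in bp.
- by move: le; rewrite nzN eqxx /=; clear; lia.
Qed.

(** Without budget every vertex of [U] would have to open a bag of its own; counting vertices
    against bags leaves no room for [v] to join the bag of [B] or of a nonempty [N]. *)
Lemma completes_card U B N k s v :
  state_ok U B N -> completes U B N k s -> v \in U ->
  v \in head set0 s :|: head set0 (behead s) ->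
  0 < (if (N == set0) && (v \notin head set0 s) then k.+1 else k).
Proof.
case/and5P=> nzB _ dUB dUN dBN [bp hB hN le] vU vs.
have cardX : #|U :|: B :|: N| = #|U| + #|B| + #|N|.
  rewrite cardsU (_ : (U :|: B) :&: N = set0); last first.
    by rewrite setIUl (disjoint_setI0 dUN) (disjoint_setI0 dBN) setU0.
  by rewrite cards0 subn0 cardsU (disjoint_setI0 dUB) cards0 subn0.
have vB := disjointFr dUB vU; have vN := disjointFr dUN vU.
have addv A : v \notin A -> #|v |: A| = #|A|.+1 by move=> h; rewrite cardsU1 h.
case: ifP => //; case: s bp hB hN le vs => [|W s] bp /= hB hN le vs.
  by rewrite !inE in vs.
have sz := bag_path_size bp; rewrite cardX in sz.
have leW := subset_leq_card hB.
have [N0|nzN] := eqVneq N set0 => /= [/negbFE vW|_].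
  have : #|v |: B| <= #|W| by apply: subset_leq_card; rewrite subUset sub1set vW.
  by rewrite addv ?vB //; move: le sz; rewrite N0 cards0 eqxx /=; clear; lia.
case: s bp hN le vs sz => [|V s] bp /= hN le vs sz.
  by case/negP: nzN; rewrite -subset0.
have [/andP[_ sWX] _ _ _ /bag_path_size sz2] := bp.
rewrite cardsD (setIidPr sWX) cardX in sz2.
have leV := subset_leq_card hN.
have : #|B| + #|N| < #|W| + #|V|.
  case/setUP: vs => vs.
    have : #|v |: B| <= #|W| by apply: subset_leq_card; rewrite subUset sub1set vs.
    by rewrite addv ?vB //; move: leV; clear; lia.
  have : #|v |: N| <= #|V| by apply: subset_leq_card; rewrite subUset sub1set vs.
  by rewrite addv ?vN //; move: leW; clear; lia.
by have := subset_leq_card sWX; move: le sz2; rewrite cardX nzN /=; clear; lia.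
Qed.

(** Converse of [completes_join] once [v] is known to lie in the first bag; [completes_card]
    supplies the unit of budget. *)
Lemma join_completes U B N k s v :
  state_ok U B N -> completes U B N k s -> v \in U -> v \in head set0 s ->
  exists2 k', k = k'.+1 & completes (U :\ v) (B :|: [set v]) N k' s.
Proof.
move=> ok co vU vh; have := completes_card ok co vU; rewrite inE vh andbF => /(_ isT).
case: k co => // k [bp hB hN le] _; exists k => //; split=> //.
- by rewrite setU_join.
- by rewrite subUset hB sub1set.
- by move: le; rewrite (cardsD1 v U) vU; clear; lia.
Qed.

Lemma next_completes U B N k s v :
  state_ok U B N -> completes U B N k s -> v \in U -> v \in head set0 (behead s) ->
  exists2 k', (if N == set0 then k.+1 else k) = k'.+1
    & completes (U :\ v) B (N :|: [set v]) k' s.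
Proof.
move=> ok co vU vh; have pos := completes_card ok co vU.
have [bp hB hN le] := co.
have good k' : #|U| + 1 <= k' + size s -> completes (U :\ v) B (N :|: [set v]) k' s.
  move=> le'; split=> //; first by rewrite setU_next.
    by rewrite subUset hN sub1set.
  by move: le'; rewrite setU1_neq0 (cardsD1 v U) vU /=; clear; lia.
move: pos le; rewrite inE vh orbT => /(_ isT).
case: eqP => [N0|_] /= pos le; first by exists k => //; apply: good; lia.
by case: k pos le {co} => // k _ le; exists k => //; apply: good; lia.
Qed.

(* A connected bag B with a single unassigned neighbour v may be closed: if a
   solution puts v into a larger first bag W, then splitting W into B and W \ B
   gives one with even more bags. *)
Lemma split_bag U B k s v :
  state_ok U B set0 -> completes U B set0 k s -> connected_set B ->
  U :&: nbr B = [set v] -> v \in head set0 s ->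
  exists2 s', completes U B set0 k s' & v \in head set0 (behead s').
Proof.
case/and5P=> nzB _ dUB _ _ [bp hB _ le] cB Fv vh.
case: s bp hB vh le => [|W s] /= bp hB vW le; first by rewrite inE in vW.
have FP u : u \in U -> u \in nbr B -> u = v.
  by move=> uU uB; apply/set1P; rewrite -Fv inE uU.
have [vU vB] : v \in U /\ v \in nbr B by apply/setIP; rewrite Fv inE.
have nvB := disjointFr dUB vU.
case: bp; rewrite setU0 => /andP[nzW sWX] cW edge adjW bp.
have WU u : u \in W -> u \notin B -> u \in U.
  by move/(subsetP sWX); rewrite inE => /orP[//|->].
have XB : (U :|: B) :\: B = U.
  apply/setP=> u; rewrite !inE; case: (boolP (u \in B)) => uB /=; last by rewrite orbF.
  by rewrite (disjointFl dUB uB).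
exists (B :: (W :\: B) :: s); last by rewrite /= inE nvB.
split; rewrite ?sub0set ?subxx //; last by move: le; clear => /=; lia.
rewrite setU0 /= XB; split=> //.
- by rewrite nzB subsetUr.
- by rewrite setIC Fv sub1set inE nvB.
- by apply/set0Pn; exists v; rewrite inE vB inE nvB.
(* The vertices left after both pieces of [W] are those left after [W], so the tail [s] stays
   valid. *)
have XW : U :\: (W :\: B) = (U :|: B) :\: W.
  apply/setP=> u; rewrite !inE; case: (boolP (u \in B)) => uB /=.
    by rewrite (disjointFl dUB uB) (subsetP hB).
  by rewrite orbF.
rewrite XW; split=> //.
- apply/andP; split; first by apply/set0Pn; exists v; rewrite inE nvB.
  by apply/subsetP=> u /setDP[uW uB]; apply: WU.
- move=> C sC nzC clC.
  have CW u : u \in C -> (u \in W) && (u \notin B) by move/(subsetP sC); rewrite inE andbC.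
  (* If [v] is in [C], then [C :|: B] is closed in [W], as [v] is the only neighbour of [B] in
     [W :\: B]. Otherwise [C] itself is closed in [W], hence equal to [W], and would contain [B]. *)
  have [vC|vC] := boolP (v \in C).
    have CB : C :|: B = W.
      apply: cW.
      + by rewrite subUset hB andbT (subset_trans sC) ?subsetDl.
      + by apply/set0Pn; exists v; rewrite inE vC.
      + apply/subsetP=> u /setIP[/nbrP[a /setUP[aC|aB] au] uW]; rewrite inE.
          have [|uB] := boolP (u \in B); rewrite ?orbT // orbF.
          apply: (subsetP clC); rewrite !inE uW uB !andbT.
          by apply/exists_inP; exists a.
        have [|uB] := boolP (u \in B); rewrite ?orbT // orbF.
        by rewrite (FP u) ?WU //; apply/nbrP; exists a.
    rewrite -CB setDUl setDv setU0; apply/esym/setDidPl; rewrite disjoints_subset.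
    by apply/subsetP=> u /CW/andP[_]; rewrite inE.
  suff CW' : C = W.
    have [b bB] := set0Pn _ nzB.
    by have := subsetP hB b bB; rewrite -CW' => /CW; rewrite bB andbF.
  apply: cW => //; first exact: subset_trans sC (subsetDl _ _).
  apply/subsetP=> u /setIP[/nbrP[a aC au] uW].
  have [uB|uB] := boolP (u \in B); last first.
    by apply: (subsetP clC); rewrite !inE uW uB !andbT; apply/exists_inP; exists a.
  case/negP: vC; have /andP[aW aB] := CW a aC.
  by rewrite -(FP a) ?WU //; apply/nbrP; exists u; rewrite // adj_sym.
- apply: subset_trans edge; apply: setSI; apply: nbrS; exact: subsetDl.
(* An edge from [W] to the next bag cannot leave from [B], whose only unassigned neighbour [v] is in
   [W]. *)
- case/orP: adjW => [-> //|/set0Pn[w /setIP[/nbrP[a aW aw] wh]]]; apply/orP; right.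
  apply/set0Pn; exists w; rewrite inE wh andbT; apply/nbrP; exists a => //.
  rewrite inE aW andbT; apply/negP=> aB.
  have := subsetP (head_bag_subset bp) w wh; rewrite !inE => /andP[wW /orP[wU|wB]].
    by case/negP: wW; rewrite (FP w) //; apply/nbrP; exists a.
  by case/negP: wW; rewrite (subsetP hB).
Qed.

(** The measure [#|U|.*2 + (N != set0)] drops in every call: assigning a vertex takes two and gives
    back at most one, closing a bag takes the one of [N]. *)
Lemma search_complete h U B N k s :
  state_ok U B N -> completes U B N k s -> #|U|.*2 + (N != set0) < h ->
  search h U B N k.
Proof.
elim: h U B N k s => // h IHh U B N k s ok co lth /=.
have /and5P[nzB sN dUB dUN dBN] := ok.
have [F0|/lowP[v vF ->]] := eqVneq (U :&: nbr B) set0; last first.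
  have [vU vB] : v \in U /\ v \in nbr B by apply/setIP.
  have lth' (N' : {set G}) : #|U :\ v|.*2 + (N' != set0) < h.
    by move: lth; rewrite (cardsD1 v U) vU; case: (N != _); case: (N' != _); clear => /=; lia.
  have next s' : completes U B N k s' -> v \in head set0 (behead s') ->
    isSome (if (if N == set0 then k.+1 else k) is k'.+1
            then search h (U :\ v) B (N :|: [set v]) k' else None).
    move=> co' vs'; have [k' -> co2] := next_completes ok co' vU vs'.
    exact: IHh (state_ok_next ok vF) co2 (lth' _).
  (* [v] is adjacent to [B], a part of the first bag, so it lies in the first or the second bag. *)
  have vs : v \in head set0 s \/ v \in head set0 (behead s).
    have [bp hB _ _] := co; case: s bp hB {co} => [|W s] bp /= hB.
      by case/negP: nzB; rewrite -subset0.
    have [_ _ /subsetP edge _ _] := bp.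
    have [vW|vW] := boolP (v \in W); [by left | right; apply: edge].
    by rewrite inE (subsetP (nbrS hB)) // !inE vW vU.
  (* No branching here: [split_bag] turns a solution with [v] in the first bag into one with [v] in
     the second. *)
  case: ifP => [/and3P[/eqP N0 Fv /connbP cB]|_].
    case: vs => [vs|]; last exact: (next s).
    have Fv1 : U :&: nbr B = [set v].
      by apply/eqP; rewrite eqEsubset sub1set vF andbT -setD_eq0.
    rewrite N0 in ok co; have [s' co' vs'] := split_bag ok co cB Fv1 vs.
    by apply: next vs'; rewrite N0.
  case: vs => vs; last first.
    by case: (match k with _.+1 => _ | _ => _ end) => // ; apply: (next s).
  have [k' -> co'] := join_completes ok co vU vs.
  have := IHh _ _ _ _ _ (state_ok_join ok vU) co' (lth' _).
  by case: (search _ _ _ _ _).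
have [bp hB hN le] := co.
case: s bp hB hN le {co} => [|W s] bp /= hB hN le; first by case/negP: nzB; rewrite -subset0.
have [/andP[nzW sWX] cW edge adjW bps] := bp.
(* Without unassigned neighbours [B] is closed in [W], because [N] belongs to the second bag. *)
have BW : B = W.
  apply: cW => //; apply/subsetP=> u /setIP[uB uW].
  have := subsetP sWX u uW; rewrite !inE -orbA => /or3P[uU|//|uN].
    by move/setP/(_ u): F0; rewrite in_setI uU uB inE.
  have := subsetP (head_bag_subset bps) u; rewrite inE uW => /(_ (subsetP hN u uN)).
  by [].
rewrite -BW in bp cW edge adjW bps *.
have XB : (U :|: B :|: N) :\: B = U :|: N.
  apply/setP=> u; rewrite !inE; case: (boolP (u \in B)) => uB /=; last by rewrite orbF.
  by rewrite (disjointFl dUB uB) (disjointFr dBN uB).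
rewrite XB in edge bps; case: connbP => // _ /=.
have [N0|nzN] := eqVneq N set0.
  rewrite N0 setU0 in bps.
  case: s bps adjW {bp hN le edge} => [/= ->|V s bps /=]; first by rewrite eqxx.
  case/set0Pn=> u /setIP[uB uV].
  have uU : u \in U by case: bps => /andP[_ /subsetP sVU] _ _ _ _; apply: sVU.
  by move/setP/(_ u): F0; rewrite inE uU uB inE.
have : search h U N set0 k.
  apply: (IHh _ _ _ _ s) (state_ok_shift ok nzN) _ _.
    split; rewrite ?setU0 ?sub0set //.
    by move: le; rewrite nzN eqxx /=; clear; lia.
  by move: lth; rewrite nzN eqxx /=; clear; lia.
by case: (search h U N set0 k).
Qed.

End Search.

(** * The program and its evaluation *)

(* The functions of the program, with their numbers and arguments:
     0 main (matrix, k in binary)       6 disconnected (matrix, A)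
     1 mux (c, (a, b))                  7 search (matrix, (k, (U, (B, N))))
     2 nbr (matrix, A)                  8 try_all (R, (matrix, (V(G), k)))
     3 low A                            9 ones s
     4 nonempty A                      10 double j
     5 grow (fuel, (matrix, (A, X)))   11 unary (k in binary)
   Vertex sets are bit vectors, and numbers are in unary unless stated otherwise. *)

(* Bitwise "if c then a else b"; missing bits of a and b count as 0, so that
   the empty list serves as the zero vector of any length. *)
Definition mux_body : exp :=
  Case (Var 0) Nil
    (Case (Var 0) Nil
      (Case (Var 3) Nil
        (Cons (Case (Var 2) (Case (Var 1) Nil (Var 0)) (Case (Var 2) Nil (Var 0)))
              (Call 1 (Cons (Var 3) (Cons (Case (Var 0) Nil (Var 1))
                                          (Case (Var 1) Nil (Var 1)))))))).

Definition nbr_body : exp :=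
  Case (Var 0) Nil
    (Case (Var 0) Nil
      (Case (Var 3) Nil
        (Case (Var 0) (Call 2 (Cons (Var 3) (Var 1)))
          (Call 1 (Cons (Var 4) (Cons (Var 4) (Call 2 (Cons (Var 5) (Var 3))))))))).

Definition low_body : exp :=
  Case (Var 0) Nil
    (Case (Var 0) (Cons Nil (Call 3 (Var 1)))
      (Cons (Cons Nil Nil) (Call 1 (Cons (Var 3) (Cons Nil Nil))))).

Definition nonempty_body : exp :=
  Case (Var 0) Nil (Case (Var 0) (Call 4 (Var 1)) (Cons Nil Nil)).

Definition grow_body : exp :=
  Case (Var 0) Nil (Case (Var 1) Nil (Case (Var 1) Nil
    (Case (Var 4) (Var 1)
      (Call 5 (Cons (Var 1) (Cons (Var 4) (Cons (Var 2)
        (Call 1 (Cons (Var 3) (Cons (Var 3)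
          (Call 1 (Cons (Var 2) (Cons (Call 2 (Cons (Var 4) (Var 3))) Nil))))))))))))).

(** The adjacency matrix doubles as the fuel of [grow], being a list of length [#|G|]. *)
Definition disconnected_body : exp :=
  Case (Var 0) Nil
    (Call 4 (Call 1
      (Cons (Call 5 (Cons (Var 0) (Cons (Var 0) (Cons (Var 1) (Call 3 (Var 1))))))
            (Cons Nil (Var 1))))).

(** The four outer [Case]s unpack the argument. The [Let]s bind [F], [low F], [U :\: low F] and the
    outcome of putting the vertex into the current bag. The fuel of [search] has no counterpart
    here. *)
Definition search_body : exp :=
  Case (Var 0) Nil (Case (Var 1) Nil (Case (Var 1) Nil (Case (Var 1) Nil
    (Let (Call 1 (Cons (Var 2) (Cons (Call 2 (Cons (Var 6) (Var 0))) Nil)))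
      (Case (Call 4 (Var 0))
        (Case (Call 6 (Cons (Var 7) (Var 1)))
          (Case (Call 4 (Var 2))
            (Case (Call 4 (Var 3)) (Cons Nil (Cons (Var 1) Nil)) Nil)
            (Case (Call 7 (Cons (Var 9) (Cons (Var 7) (Cons (Var 5) (Cons (Var 4)
                     (Call 1 (Cons (Var 4) (Cons Nil Nil))))))))
              Nil
              (Cons Nil (Cons (Var 5) (Var 1)))))
          Nil)
        (Let (Call 3 (Var 2))
          (Let (Call 1 (Cons (Var 0) (Cons Nil (Var 6))))
            (Let
              (Case
                (Case (Call 4 (Var 6))
                  (Case (Call 4 (Call 1 (Cons (Var 1) (Cons Nil (Var 4)))))
                    (Call 6 (Cons (Var 11) (Var 5)))
                    (Cons Nil Nil))
                  (Cons Nil Nil))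
                Nil
                (Case (Var 11) Nil
                  (Call 7 (Cons (Var 15) (Cons (Var 1) (Cons (Var 4)
                    (Cons (Call 1 (Cons (Var 9) (Cons (Var 9) (Var 5)))) (Var 10))))))))
              (Case (Var 0)
                (Case (Case (Call 4 (Var 7)) (Cons Nil (Var 10)) (Var 12)) Nil
                  (Call 7 (Cons (Var 14) (Cons (Var 1) (Cons (Var 3) (Cons (Var 8)
                    (Call 1 (Cons (Var 9) (Cons (Var 9) (Var 4))))))))))
                (Var 2)))))))))).

Definition try_all_body : exp :=
  Case (Var 0) Nil (Case (Var 1) Nil (Case (Var 1) Nil
    (Case (Call 4 (Var 4)) Nil
      (Let (Call 3 (Var 6))
        (Let (Call 7 (Cons (Var 5) (Cons (Var 4)
                (Cons (Call 1 (Cons (Var 0) (Cons Nil (Var 3))))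
                  (Cons (Var 0) (Call 1 (Cons (Var 0) (Cons Nil Nil))))))))
          (Case (Var 0)
            (Call 8 (Cons (Call 1 (Cons (Var 1) (Cons Nil (Var 8))))
                      (Cons (Var 6) (Cons (Var 4) (Var 5)))))
            (Var 2))))))).

Definition ones_body : exp :=
  Case (Var 0) Nil (Cons (Cons Nil Nil) (Call 9 (Var 1))).

Definition double_body : exp :=
  Case (Var 0) Nil (Cons Nil (Cons Nil (Call 10 (Var 1)))).

Definition unary_body : exp :=
  Case (Var 0) Nil
    (Let (Call 10 (Call 11 (Var 1))) (Case (Var 1) (Var 0) (Cons Nil (Var 2)))).

Definition main_body : exp :=
  Case (Var 0) Nil
    (Let (Call 9 (Var 0))
      (Let (Call 11 (Var 2))
        (Call 8 (Cons (Var 1) (Cons (Var 2) (Cons (Var 1) (Var 0))))))).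

Definition path_program : program :=
  [:: main_body; mux_body; nbr_body; low_body; nonempty_body; grow_body;
      disconnected_body; search_body; try_all_body; ones_body; double_body;
      unary_body].

(** Coin-free evaluation: whatever tosses are to come, they are left untouched. An upper bound on
    the time can be rounded, unlike the exact time of [eval]. *)
Definition ev env e v T : Prop :=
  exists2 t, t <= T & forall w, eval path_program env e w v w t.

Definition call f u v T : Prop := ev [:: u] (nth Nil path_program f) v T.

Lemma ev_Var env i v : nth Leaf env i = v -> ev env (Var i) v 1.
Proof. by move=> <-; exists 1 => // w; apply: eval_Var. Qed.

Lemma ev_Nil env : ev env Nil Leaf 1.
Proof. by exists 1 => // w; apply: eval_Nil. Qed.

Lemma ev_Cons env e1 e2 v1 v2 T1 T2 :
  ev env e1 v1 T1 -> ev env e2 v2 T2 ->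
  ev env (Cons e1 e2) (Node v1 v2) (T1 + T2).+1.
Proof.
move=> [t1 le1 ev1] [t2 le2 ev2]; exists (t1 + t2).+1; first by rewrite ltnS leq_add.
by move=> w; apply: eval_Cons (ev1 w) (ev2 w).
Qed.

(** One premise serves both branches, so that [evs] need not choose: it reduces once [u] is
    known. *)
Lemma ev_Case env e e0 e1 u v T1 T2 :
  ev env e u T1 ->
  (if u is Node a b then ev (a :: b :: env) e1 v T2 else ev env e0 v T2) ->
  ev env (Case e e0 e1) v (T1 + T2).+1.
Proof.
case: u => [|a b] [t1 le1 ev1] [t2 le2 ev2]; exists (t1 + t2).+1;
  rewrite ?ltnS ?leq_add // => w.
- exact: eval_Case0 (ev1 w) (ev2 w).
- exact: eval_Case1 (ev1 w) (ev2 w).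
Qed.

Lemma ev_Let env e1 e2 u v T1 T2 :
  ev env e1 u T1 -> ev (u :: env) e2 v T2 -> ev env (Let e1 e2) v (T1 + T2).+1.
Proof.
move=> [t1 le1 ev1] [t2 le2 ev2]; exists (t1 + t2).+1; first by rewrite ltnS leq_add.
by move=> w; apply: eval_Let (ev1 w) (ev2 w).
Qed.

Lemma ev_Call env f e u v T1 T2 :
  ev env e u T1 -> call f u v T2 -> ev env (Call f e) v (T1 + T2).+1.
Proof.
move=> [t1 le1 ev1] [t2 le2 ev2]; exists (t1 + t2).+1; first by rewrite ltnS leq_add.
by move=> w; apply: eval_Call (ev1 w) (ev2 w).
Qed.

(** Value and time are found by unification while the body is evaluated, and only then compared with
    the required ones. *)
Lemma call_le f u v v' T T' : call f u v' T' -> v' = v -> T' <= T -> call f u v T.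
Proof. by move=> [t le1 ev1] <- le2; exists t => //; apply: leq_trans le2. Qed.

(* [tac] closes the [call] goals. *)
Ltac evs tac :=
  lazymatch goal with
  | |- ev _ (Var _) _ _ => refine (ev_Var _); lazy beta iota delta [nth]; reflexivity
  | |- ev _ Nil _ _ => exact (ev_Nil _)
  | |- ev _ (Cons _ _) _ _ => eapply ev_Cons; [evs tac | evs tac]
  | |- ev _ (Case _ _ _) _ _ => eapply ev_Case; [evs tac | lazy beta iota; evs tac]
  | |- ev _ (Let _ _) _ _ => eapply ev_Let; [evs tac | evs tac]
  | |- ev _ (Call _ _) _ _ => eapply ev_Call; [evs tac | tac tt]
  end.

Ltac enter :=
  lazymatch goal with
  | |- call ?f ?u ?v ?T =>
      let b := eval lazy in (nth Nil path_program f) in change (ev [:: u] b v T)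
  end.

Tactic Notation "run" "with" tactic0(tac) :=
  eapply call_le; [enter; let t _ := tac in evs t | | ].

Definition bits (s : seq bool) : tree := list_tree [seq bit_tree b | b <- s].

Lemma bits_cons x s : bits (x :: s) = Node (bit_tree x) (bits s).
Proof. by []. Qed.

Lemma bits_nil : bits [::] = Leaf.
Proof. by []. Qed.

(** * Bit vectors and numbers *)

Fixpoint mux (c a b : seq bool) : seq bool :=
  if c is x :: c' then
    (if x then head false a else head false b) :: mux c' (behead a) (behead b)
  else [::].

Lemma call_mux c a b :
  call 1 (Node (bits c) (Node (bits a) (bits b))) (bits (mux c a b))
       (30 * (size c).+1).
Proof.
elim: c a b => [|x c IHc] a b.
  by rewrite bits_nil; run with (fail).
have IH := IHc (behead a) (behead b).
rewrite bits_cons; case: x a b IH => [] [|y a] [|z b] IH;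
  rewrite ?bits_cons ?bits_nil /bit_tree.
all: run with (eapply IH); [done | cbn [size]; clear; lia].
Qed.

(** The bitwise or of the rows selected by [S], since [mux row row] is an or. With no row selected
    the result is [[::]], not a zero vector. *)
Fixpoint nbrb (M : seq (seq bool)) (S : seq bool) : seq bool :=
  match M, S with
  | row :: M', x :: S' => if x then mux row row (nbrb M' S') else nbrb M' S'
  | _, _ => [::]
  end.

Lemma call_nbrb n M S : all (fun row => size row <= n) M ->
  call 2 (Node (list_tree [seq bits row | row <- M]) (bits S)) (bits (nbrb M S))
       (50 * n.+1 * (size M).+1).
Proof.
elim: M S => [|row M IHM] S; rewrite [list_tree _]/=.
  by move=> _; run with (fail); [ | clear; lia].
case/andP=> le /IHM{}IHM; case: S => [|x S]; rewrite ?bits_nil ?bits_cons.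
  by run with (fail); [ | clear; lia].
have IH := IHM S; case: x; rewrite /bit_tree.
- run with (first [eapply IH | eapply call_mux]); first done.
  by rewrite [X in _ <= X]mulnS; move: (_ * (size M).+1) le; clear; lia.
- run with (eapply IH); first done.
  by rewrite [X in _ <= X]mulnS; move: (_ * (size M).+1); clear; lia.
Qed.

Fixpoint lowb (s : seq bool) : seq bool :=
  if s is x :: s' then if x then true :: mux s' [::] [::] else false :: lowb s'
  else [::].

Lemma call_lowb s : call 3 (bits s) (bits (lowb s)) (50 * (size s).+1).
Proof.
elim: s => [|x s IHs].
  by rewrite bits_nil; run with (fail).
rewrite bits_cons; case: x; rewrite /bit_tree.
- by run with (exact: (@call_mux s [::] [::])); [ | cbn [size]; clear; lia].
- by run with (eapply IHs); [ | cbn [size]; clear; lia].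
Qed.

Lemma call_has s : call 4 (bits s) (bit_tree (has id s)) (20 * (size s).+1).
Proof.
elim: s => [|x s IHs].
  by rewrite bits_nil; run with (fail).
rewrite bits_cons; case: x; rewrite /bit_tree.
- by run with (fail); [ | cbn [size]; clear; lia].
- by run with (eapply IHs); [ | cbn [size]; clear; lia].
Qed.

Lemma call_ones s : call 9 (list_tree s) (bits (nseq (size s) true)) (20 * (size s).+1).
Proof.
elim: s => [|x s IHs]; rewrite [list_tree _]/=.
  by run with (fail).
by run with (eapply IHs); [ | cbn [size]; clear; lia].
Qed.

Definition unary_tree (j : nat) : tree := list_tree (nseq j Leaf).

Lemma call_double j : call 10 (unary_tree j) (unary_tree j.*2) (20 * j.+1).
Proof.
elim: j => [|j IHj].
  by rewrite -[unary_tree 0]/Leaf; run with (fail).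
rewrite -[unary_tree j.+1]/(Node Leaf (unary_tree j)).
by run with (eapply IHj); [ | clear; lia].
Qed.

Definition bits_value (s : seq bool) : nat := foldr (fun (b : bool) u => b + u.*2) 0 s.

Lemma call_unary s :
  call 11 (bits s) (unary_tree (bits_value s)) (50 * (size s).+1 * (bits_value s).+1).
Proof.
elim: s => [|x s IHs].
  by rewrite bits_nil; run with (fail).
(* The recursive call and the doubling of its result, linear in the value, fit into the bound for
   one more bit. *)
have le_cost b : 50 * (size s).+1 * (bits_value s).+1 + 50 * (bits_value s).+1 <=
    50 * (size s).+2 * (b + (bits_value s).*2).+1.
  by rewrite -mulnDl addnC -mulnS leq_mul // -addnn; clear; lia.
rewrite bits_cons; case: x (le_cost x); rewrite /bit_tree => le.
all: run with (first [eapply IHs | eapply call_double]); first done.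
all: apply: leq_trans le; move: (_ * (bits_value s).+1); clear; lia.
Qed.

(** Dropping the lowest bit replaces [k] by [k %/ 2], so the induction on [L] varies [k]. *)
Lemma bits_value_mod k L :
  bits_value (mkseq (fun i => odd (k %/ 2 ^ i)) L) = k %% 2 ^ L.
Proof.
elim: L k => [|L IHL] k; first by rewrite modn1.
rewrite -[mkseq _ _]/(odd (k %/ 2 ^ 0) :: [seq odd (k %/ 2 ^ i) | i <- iota 1 L]).
rewrite divn1 /= -[in LHS](addn0 1) iotaDl -map_comp.
rewrite (_ : map _ _ = mkseq (fun i => odd (k %/ 2 %/ 2 ^ i)) L); last first.
  by apply: eq_map => i /=; rewrite -divnMA expnS.
rewrite -/(bits_value _) IHL expnS.
have D0 : 0 < 2 ^ L by rewrite expn_gt0.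
have lt := ltn_pmod (k %/ 2) D0; have kE := divn_eq (k %/ 2) (2 ^ L).
have kE2 : k = (k %/ 2) %/ 2 ^ L * (2 * 2 ^ L) + (odd k + ((k %/ 2) %% 2 ^ L).*2).
  rewrite -[LHS](odd_double_half k) -divn2 {1}kE mulnCA.
  by move: (_ %% _) (_ * 2 ^ L) (odd k : nat); clear; lia.
rewrite [in RHS]kE2 modnMDl [in RHS]modn_small //.
by move: lt (leq_b1 (odd k)); move: (_ %% _); move: (2 ^ L) (odd k : nat); clear; lia.
Qed.

Lemma nat_tree_bits k :
  exists2 s, nat_tree k = bits s & bits_value s = k /\ size s <= k.+1.
Proof.
exists (mkseq (fun i => odd (k %/ 2 ^ i)) (trunc_log 2 k).+1).
  by rewrite /nat_tree /bits /mkseq -map_comp.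
split; last first.
  rewrite size_mkseq ltnS; case: k => [|k] //.
  by apply: leq_trans (trunc_logP (isT : 1 < 2) (isT : 0 < k.+1)); apply/ltnW/ltn_expl.
by rewrite bits_value_mod modn_small // trunc_log_ltn.
Qed.

(** * Vertex sets as bit vectors *)

Section MuxMap.
Variables (T : Type) (f g h : T -> bool).

Lemma mux_map s :
  mux (map f s) (map g s) (map h s) = [seq if f x then g x else h x | x <- s].
Proof. by elim: s => //= x s ->. Qed.

Lemma mux_map_nill s :
  mux (map f s) [::] (map h s) = [seq ~~ f x && h x | x <- s].
Proof. by elim: s => //= x s ->; case: (f x). Qed.

Lemma mux_map_nilr s :
  mux (map f s) (map g s) [::] = [seq f x && g x | x <- s].
Proof. by elim: s => //= x s ->; case: (f x). Qed.

Lemma mux_map_nil s : mux (map f s) [::] [::] = [seq false | x <- s].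
Proof. by elim: s => //= x s ->; case: (f x). Qed.

End MuxMap.

Section SetPrograms.
Variable G : sgraph.
Implicit Types A B N U X : {set G}.

Definition sbits A : seq bool := [seq x \in A | x <- enum G].

Lemma size_sbits A : size (sbits A) = #|G|.
Proof. by rewrite size_map -cardE. Qed.

Lemma vset_treeE A : vset_tree A = bits (sbits A).
Proof. by rewrite /bits -map_comp. Qed.

(** Named so that [lia] treats the powers as atoms in the cost estimates. *)
Definition gcost i : nat := #|G|.+1 ^ i.

Lemma gcost_mono : [/\ 0 < gcost 1, gcost 1 <= gcost 2 & gcost 2 <= gcost 3].
Proof. by rewrite /gcost expn_gt0 !leq_pexp2l. Qed.

Lemma gcostM i : gcost i * #|G|.+1 = gcost i.+1.
Proof. by rewrite mulnC -expnS. Qed.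

Lemma gcost1 : #|G|.+1 = gcost 1.
Proof. by rewrite /gcost expn1. Qed.

Lemma call_union A B :
  call 1 (Node (vset_tree A) (Node (vset_tree A) (vset_tree B)))
         (vset_tree (A :|: B)) (30 * gcost 1).
Proof.
rewrite !vset_treeE; eapply call_le; [exact: call_mux | | by rewrite size_sbits gcost1].
rewrite mux_map; congr (bits _); apply: eq_map => x.
by rewrite inE; case: (x \in A).
Qed.

Lemma call_diff A B :
  call 1 (Node (vset_tree B) (Node Leaf (vset_tree A))) (vset_tree (A :\: B)) (30 * gcost 1).
Proof.
rewrite !vset_treeE -bits_nil.
eapply call_le; [exact: call_mux | | by rewrite size_sbits gcost1].
by rewrite mux_map_nill; congr (bits _); apply: eq_map => x; rewrite inE.
Qed.

Lemma call_zero A :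
  call 1 (Node (vset_tree A) (Node Leaf Leaf)) (vset_tree (@set0 G)) (30 * gcost 1).
Proof.
rewrite !vset_treeE -bits_nil.
eapply call_le; [exact: call_mux | | by rewrite size_sbits gcost1].
by rewrite mux_map_nil; congr (bits _); apply: eq_map => x; rewrite inE.
Qed.

Definition matrix : seq (seq bool) := [seq [seq adj x y | y <- enum G] | x <- enum G].

Lemma graph_treeE : graph_tree G = list_tree [seq bits row | row <- matrix].
Proof.
rewrite /graph_tree /matrix -[in RHS]map_comp; congr list_tree; apply: eq_map => x.
by rewrite /= /bits -map_comp.
Qed.

Lemma nbrb_map A (s t : seq G) :
  nbrb [seq [seq adj x y | y <- t] | x <- s] [seq x \in A | x <- s] =
  if has (mem A) s then [seq has (fun x => (x \in A) && adj x y) s | y <- t] else [::].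
Proof.
elim: s => //= x s ->; case: (x \in A) => //=.
case: ifP => [_|/hasPn nA].
  by rewrite mux_map; apply: eq_map => y; case: (adj x y).
rewrite mux_map_nilr; apply: eq_map => y; rewrite andbb -[LHS]orbF; congr (_ || _).
by apply/esym/hasPn => z /nA /= /negbTE ->.
Qed.

(** Not always [vset_tree (nbr A)]: for empty [A] it is the empty list. Masking with [U] in
    [call_inter] restores the length. *)
Definition nbits A : tree := bits (nbrb matrix (sbits A)).

Lemma call_nbr A : call 2 (Node (graph_tree G) (vset_tree A)) (nbits A) (50 * gcost 2).
Proof.
rewrite graph_treeE vset_treeE; eapply call_le.
- apply: (@call_nbrb #|G|); apply/allP=> row /mapP[x _ ->].
  by rewrite size_map -cardE.
- by [].
- by rewrite size_map -cardE -mulnA [X in _ * X]mulnC gcost1 -{2}gcost1 gcostM.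
Qed.

Lemma call_inter A U :
  call 1 (Node (vset_tree U) (Node (nbits A) Leaf)) (vset_tree (U :&: nbr A)) (30 * gcost 1).
Proof.
rewrite !vset_treeE -bits_nil.
eapply call_le; [exact: call_mux | | by rewrite size_sbits gcost1].
congr (bits _); rewrite nbrb_map; case: ifP => [_|/hasPn nA].
  rewrite mux_map_nilr; apply: eq_map => y; rewrite inE; congr (_ && _).
  apply/hasP/nbrP => [[x _ /andP[xA xy]]|[x xA xy]]; exists x => //.
    by rewrite mem_enum.
  by rewrite xA.
rewrite mux_map_nil; apply: eq_map => y; rewrite inE; apply/esym/negbTE.
by apply/nandP; right; apply/nbrP => -[x xA]; case/negP: (nA x (mem_enum _ x)).
Qed.

(** An arbitrary list replaces [enum G] for the induction; without duplicates only one position is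
    set. *)
Lemma lowb_map A (s : seq G) : uniq s ->
  lowb [seq x \in A | x <- s] =
  [seq x \in (if [seq x <- s | x \in A] is y :: _ then [set y] else set0) | x <- s].
Proof.
elim: s => //= x s IHs /andP[xs us]; case: ifP => xA.
  rewrite inE eqxx mux_map_nil; congr (_ :: _); apply/eq_in_map => y ys.
  by rewrite inE; apply/esym/negbTE; apply: contraNneq xs => <-.
rewrite (IHs us); congr (_ :: _); case E: [seq y <- s | y \in A] => [|y r]; rewrite inE //.
apply/esym/negbTE; apply: contraFneq xA => ->.
by have := mem_head y r; rewrite -E mem_filter => /andP[].
Qed.

Lemma call_low A : call 3 (vset_tree A) (vset_tree (low A)) (50 * gcost 1).
Proof.
rewrite !vset_treeE; eapply call_le; [exact: call_lowb | | by rewrite size_sbits gcost1].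
have eA : enum A = [seq x <- enum G | x \in A] by rewrite enumT.
by rewrite lowb_map ?enum_uniq // -eA /sbits /low; case: (enum A).
Qed.

Lemma has_sbits A : has id (sbits A) = (A != set0).
Proof.
rewrite has_map; apply/hasP/set0Pn => [[x _ xA]|[x xA]]; exists x => //.
by rewrite mem_enum.
Qed.

Lemma call_nonempty A : A != set0 -> call 4 (vset_tree A) (Node Leaf Leaf) (20 * gcost 1).
Proof.
move=> nzA; rewrite vset_treeE.
by eapply call_le; [exact: call_has | rewrite has_sbits nzA | rewrite size_sbits gcost1].
Qed.

Lemma call_empty A : A == set0 -> call 4 (vset_tree A) Leaf (20 * gcost 1).
Proof.
move=> A0; rewrite vset_treeE.
by eapply call_le; [exact: call_has | rewrite has_sbits A0 | rewrite size_sbits gcost1].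
Qed.

Lemma call_grow s A X :
  call 5 (Node (list_tree s) (Node (graph_tree G) (Node (vset_tree A) (vset_tree X))))
       (vset_tree (iter (size s) (fun Y => Y :|: A :&: nbr Y) X))
       (150 * gcost 2 * (size s).+1).
Proof.
have [c1 c2 c3] := gcost_mono.
elim: s X => [|x s IHs] X; rewrite [list_tree _]/=.
  by run with (fail); [ | lia].
run with (first [exact: call_union | exact: call_inter | exact: call_nbr | exact: IHs]).
  by rewrite -iterSr.
rewrite [X in _ <= X]mulnS; move: (_ * (size s).+1) c1 c2; clear; lia.
Qed.

Lemma call_reach A :
  call 5 (Node (graph_tree G) (Node (graph_tree G) (Node (vset_tree A) (vset_tree (low A)))))
       (vset_tree (reach A)) (150 * gcost 3).
Proof.
have := call_grow [seq bits row | row <- matrix] A (low A).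
by rewrite -graph_treeE !size_map -enumT -cardE -mulnA gcostM.
Qed.

Lemma call_connected A :
  connb A -> call 6 (Node (graph_tree G) (vset_tree A)) Leaf (300 * gcost 3).
Proof.
move=> cA; have [c1 c2 c3] := gcost_mono.
run with (first [exact: call_low | exact: call_reach | exact: call_diff
                | exact: (call_empty cA)]); first done.
move: c1 c2 c3; clear; lia.
Qed.

Lemma call_disconnected A :
  ~~ connb A -> call 6 (Node (graph_tree G) (vset_tree A)) (Node Leaf Leaf) (300 * gcost 3).
Proof.
move=> cA; have [c1 c2 c3] := gcost_mono.
run with (first [exact: call_low | exact: call_reach | exact: call_diff
                | exact: (call_nonempty cA)]); first done.
move: c1 c2 c3; clear; lia.
Qed.

End SetPrograms.

(** Bounds one call of the search apart from its recursive calls. The cube comes from the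
    connectivity test: [#|G|] rounds of quadratic cost. *)
Definition step_cost (G : sgraph) : nat := 2000 * gcost G 3.

Ltac set_call :=
  first [ exact: call_nbr | exact: call_inter | exact: call_union | exact: call_diff
        | exact: call_zero | exact: call_low
        | apply: call_nonempty; assumption | apply: call_empty; assumption
        | apply: call_connected; assumption | apply: call_disconnected; assumption
        | eassumption ].

Ltac within_step_cost :=
  rewrite /step_cost;
  match goal with |- context [gcost ?G _] => case: (gcost_mono G) end; clear; lia.

(** * Correctness and running time of the search program *)

Section SearchProgram.
Variable G : sgraph.
Implicit Types A B N U X : {set G}.
Local Notation step_cost := (step_cost G).

Definition search_arg U B N k : tree :=
  Node (graph_tree G)
    (Node (unary_tree k) (Node (vset_tree U) (Node (vset_tree B) (vset_tree N)))).

Definition answer (r : option (seq {set G})) : tree :=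
  if r is Some s then answer_yes s else answer_no.


(* The second bound makes up for the free choice in the branching on the first
   vertex of the next bag: each of the two children of the resulting state
   spends budget, so that there are 3 children of smaller budget in total. *)
Lemma call_search h U B N k : #|U|.*2 + (N != set0) < h ->
  exists T, [/\ call 7 (search_arg U B N k) (answer (search h U B N k)) T,
      T <= 2 * (step_cost * h * 3 ^ k)
    & N != set0 -> (U :&: nbr B != set0) || ~~ connb B ->
      T <= step_cost + (if k is k'.+1 then 4 * (step_cost * h * 3 ^ k') else 0)].
Proof.
elim: h U B N k => // h IHh U B N k lth; rewrite /search_arg in IHh *.
have pos j : step_cost <= step_cost * 3 ^ j by rewrite leq_pmulr // expn_gt0.
have mulS j : step_cost * h.+1 * 3 ^ j = step_cost * h * 3 ^ j + step_cost * 3 ^ j.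
  by rewrite mulnS mulnDl addnC.
have leT1 T1 : T1 <= 2 * (step_cost * h * 3 ^ k) ->
    step_cost + T1 <= 2 * (step_cost * h.+1 * 3 ^ k).
  by rewrite mulS; move: (pos k); move: (step_cost * 3 ^ k) (_ * 3 ^ k); clear; lia.
have le_step : step_cost <= 2 * (step_cost * h.+1 * 3 ^ k).
  by have := leT1 0 isT; rewrite addn0.
have [F0|nF] := boolP (U :&: nbr B == set0).
  have [cB|nB] := boolP (connb B); last first.
    exists step_cost; split=> [||_ _] //; last exact: leq_addr.
    run with (set_call); last within_step_cost.
    by rewrite /= F0 nB.
  have [N0|nN] := boolP (N == set0).
    exists step_cost; split=> //.
    have [U0|nU] := boolP (U == set0).
      run with (set_call); last within_step_cost.
      by rewrite /= F0 cB N0 U0.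
    run with (set_call); last within_step_cost.
    by rewrite /= F0 cB N0 (negbTE nU).
  have [|T1 [call1 le1 _]] := IHh U N set0 k.
    by move: lth; rewrite nN eqxx /=; clear; lia.
  exists (step_cost + T1); split=> //; last exact: leT1.
  rewrite /= F0 cB (negbTE nN) /=.
  case: (search h U N set0 k) call1 => [s|]; rewrite /answer /answer_yes /answer_no => call1.
    by run with (set_call); last within_step_cost.
  by run with (set_call); last within_step_cost.
have lth' (N' : {set G}) : #|U :\: low (U :&: nbr B)|.*2 + (N' != set0) < h.
  have [v /setIP[vU _] ->] := lowP nF.
  by move: lth; rewrite (cardsD1 v U) vU; case: (N != _); case: (N' != _); clear => /=; lia.
have IHjoin k' := IHh (U :\: low (U :&: nbr B)) (B :|: low (U :&: nbr B)) N k' (lth' _).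
have IHnext k' := IHh (U :\: low (U :&: nbr B)) B (N :|: low (U :&: nbr B)) k' (lth' _).
have nNv : N :|: low (U :&: nbr B) != set0.
  by have [x _ ->] := lowP nF; apply: setU1_neq0.
have Fv : (U :\: low (U :&: nbr B)) :&: nbr B = (U :&: nbr B) :\: low (U :&: nbr B).
  by rewrite !setDE setIAC.
have u0 : unary_tree 0 = Leaf by [].
have uS j : unary_tree j.+1 = Node Leaf (unary_tree j) by [].
have mul3 j : step_cost * h * 3 ^ j.+1 = 3 * (step_cost * h * 3 ^ j).
  by rewrite expnS mulnCA.
have [N0|nN] := boolP (N == set0).
  have [T2 [call2 le2 le2']] := IHnext k; rewrite Fv in le2'.
  have {le2'} le2' := le2' nNv.
  (* The second bound applies to the child whose next bag has just been opened. For positive [k], up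
     to a common factor, it gives [4 * 3 ^ k.-1], which with [2 * 3 ^ k.-1] for the other child
     makes [2 * 3 ^ k]. Passing from [h] to [h.+1] pays for the two steps. *)
  have free : ((U :&: nbr B) :\: low (U :&: nbr B) != set0) || ~~ connb B ->
      (if k is k'.+1 then 2 * (step_cost * h * 3 ^ k') else 0) + T2 + step_cost <=
      2 * (step_cost * h.+1 * 3 ^ k).
    move/le2'; rewrite mulS; case: (k) => [|k'] /=.
      by move: (pos 0); move: (step_cost * 3 ^ 0) (_ * 3 ^ 0); clear; lia.
    move: (pos k'.+1); rewrite mul3.
    by move: (step_cost * 3 ^ k'.+1) (_ * 3 ^ k'); clear; lia.
  have [Fv0|nFv] := boolP ((U :&: nbr B) :\: low (U :&: nbr B) == set0).
    have [cB|nB] := boolP (connb B).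
      (* A forced move: one child with the same budget, paid for by the drop of the fuel. *)
      exists (step_cost + T2); split; [|exact: leT1|by []].
      run with (set_call); last within_step_cost.
      by rewrite /= (negbTE nF) N0 Fv0 cB.
    rewrite nB orbT in free; have {}free := free isT.
    case: k {leT1 le_step le2 le2' IHnext} call2 free => [|k] call2 free.
      exists (step_cost + T2); split; [|by rewrite addnC|by []].
      rewrite u0; run with (set_call); last within_step_cost.
      by rewrite /= (negbTE nF) N0 Fv0 (negbTE nB).
    have [T1 [call1 le1 _]] := IHjoin k.
    exists (step_cost + T1 + T2); split; [|by move: le1 free; clear; lia|by []].
    rewrite /= (negbTE nF) N0 Fv0 (negbTE nB) /=.
    case: (search h _ _ N k) call1 => [s|]; rewrite /= /answer_yes /answer_no => call1.
      by rewrite uS; run with (set_call); last within_step_cost.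
    by rewrite uS; run with (set_call); last within_step_cost.
  rewrite nFv in free; have {}free := free isT.
  case: k {leT1 le_step le2 le2' IHnext} call2 free => [|k] call2 free.
    exists (step_cost + T2); split; [|by rewrite addnC|by []].
    rewrite u0; run with (set_call); last within_step_cost.
    by rewrite /= (negbTE nF) N0 (negbTE nFv).
  have [T1 [call1 le1 _]] := IHjoin k.
  exists (step_cost + T1 + T2); split; [|by move: le1 free; clear; lia|by []].
  rewrite /= (negbTE nF) N0 (negbTE nFv) /=.
  case: (search h _ _ N k) call1 => [s|]; rewrite /= /answer_yes /answer_no => call1.
    by rewrite uS; run with (set_call); last within_step_cost.
  by rewrite uS; run with (set_call); last within_step_cost.
case: k {leT1} le_step => [|k] le_step.
  exists step_cost; split=> [||_ _] //; last by rewrite addn0.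
  rewrite u0; run with (set_call); last within_step_cost.
  by rewrite /= (negbTE nF) (negbTE nN).
(* Both children have budget [k] where the state has [k.+1]: the factor [4 * 3 ^ k] is that of the
   second bound, and it is below [2 * 3 ^ k.+1]. *)
have [T1 [call1 le1 _]] := IHjoin k; have [T2 [call2 le2 _]] := IHnext k.
have le : step_cost + T1 + T2 <= step_cost + 4 * (step_cost * h * 3 ^ k).
  by move: le1 le2; move: (_ * 3 ^ k); clear; lia.
exists (step_cost + T1 + T2); split.
- rewrite /= (negbTE nF) (negbTE nN) uS.
  case: (search h _ _ N k) call1 => [s|]; rewrite /= /answer_yes /answer_no => call1.
    by run with (set_call); last within_step_cost.
  by run with (set_call); last within_step_cost.
- apply: leq_trans le _; rewrite mulS mul3; move: (pos k.+1).
  by move: (step_cost * 3 ^ k.+1) (_ * 3 ^ k); clear; lia.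
- move=> _ _; apply: leq_trans le _; rewrite mulS.
  by move: (step_cost * 3 ^ k) (_ * 3 ^ k); clear; lia.
Qed.

End SearchProgram.

(** * Arithmetic of the running time *)

Lemma unary_cost_le k : 50 * k.+2 * k.+1 <= 100 * 4 ^ k.
Proof.
have -> : 4 ^ k = 2 ^ k * 2 ^ k by rewrite -expnMn.
have := ltn_expl k (isT : 1 < 2); move: (2 ^ k) => x lt.
by apply: (@leq_trans (50 * (2 * x) * x)); [apply: leq_mul => //; lia | lia].
Qed.

(** [X] stands for [3 ^ k]. The fifth power collects the start vertices, the cubic [step_cost] and
    the fuel; the constants sum to [5 * 2000 + 40], below [2 ^ 14]. *)
Lemma main_cost_le n X c : 0 < X -> c = 2000 * n.+1 ^ 3 ->
  n.+1 * (2 * (c * n.*2.+1 * X) + c) + 20 * n.+1 + 20 <= 2 ^ 14 * (n.+1 ^ 5 * X).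
Proof.
move=> X0 ->; set q := n.+1; have q0 : 0 < q by [].
have le2 : n.*2.+1 <= 2 * q by rewrite /q; lia.
have e5 : q ^ 5 = q * q ^ 3 * q by rewrite -expnS -expnSr.
have qY i : i <= 5 -> q ^ i <= q ^ 5 * X.
  by move=> le; rewrite -[q ^ i]muln1 leq_mul // leq_pexp2l.
have h1 : q * (2 * (2000 * q ^ 3 * n.*2.+1 * X)) <= (4 * 2000) * (q ^ 5 * X).
  rewrite e5; apply: (@leq_trans (q * (2 * (2000 * q ^ 3 * (2 * q) * X)))).
    by rewrite !leq_mul.
  by move: (q ^ 3) => y; clear; lia.
have h2 : q * (2000 * q ^ 3) <= 2000 * (q ^ 5 * X).
  by rewrite mulnCA -expnS leq_mul // qY.
have h3 := qY 1 isT; have h4 := qY 0 isT; rewrite expn1 in h3; rewrite expn0 in h4.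
have e14 : (5 * 2000 + 40) <= 2 ^ 14 by [].
apply: (@leq_trans ((5 * 2000 + 40) * (q ^ 5 * X))); last by rewrite leq_mul2r e14 orbT.
rewrite mulnDr; move: h1 h2 h3 h4; move: (q ^ 5 * X) (q * (2 * _)) (q * (2000 * _)); clear; lia.
Qed.

Lemma exp3_tradeoff n k :
  2 ^ 14 * (n.+1 ^ 5 * 3 ^ k) + 100 * 4 ^ k <= 4 ^ (k + 30) + n ^ 64.
Proof.
have e100 : 100 * 4 ^ k <= 4 ^ 29 * 4 ^ k.
  by rewrite leq_mul2r (@leq_trans (4 ^ 4)) ?orbT // leq_pexp2l.
have e30 : 4 ^ (k + 30) = 4 * (4 ^ 29 * 4 ^ k) by rewrite addnC expnD -[30]/(29.+1) expnS mulnA.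
have e2 i : 2 ^ i.*2 = 4 ^ i by rewrite -mul2n expnM.
have small i x : i <= 29 -> x <= 4 ^ i -> x <= 4 ^ 29 * 4 ^ k.
  move=> le lex; apply: leq_trans lex _; apply: (@leq_trans (4 ^ 29)); first by rewrite leq_pexp2l.
  by rewrite leq_pmulr // expn_gt0.
rewrite {}e30; have [le|/ltnW gt] := leqP (n.+1 ^ 5 * 3 ^ k) (4 ^ k).
  have : 2 ^ 14 * (n.+1 ^ 5 * 3 ^ k) <= 4 ^ 29 * 4 ^ k.
    by apply: leq_mul le; rewrite (e2 7) leq_pexp2l.
  by move: e100; move: (4 ^ 29 * _) (n ^ 64) (2 ^ 14 * _); clear; lia.
(* [(3 ^ k) ^ 5 <= (4 ^ k) ^ 4 <= (n.+1 ^ 5 * 3 ^ k) ^ 4], by [3 ^ 5 <= 4 ^ 4]; then [(3 ^ k) ^ 4]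
   cancels. *)
have {gt} le3 : 3 ^ k <= n.+1 ^ 20.
  have p0 : 0 < (3 ^ k) ^ 4 by rewrite !expn_gt0.
  rewrite -(leq_pmul2r p0) -expnS.
  apply: (@leq_trans ((4 ^ k) ^ 4)).
    rewrite -!expnM mulnC (mulnC k) !expnM.
    by case: (k) => // k'; rewrite leq_exp2r.
  by rewrite -[20]/(5 * 4) expnM -expnMn leq_exp2r.
have le25 : 2 ^ 14 * (n.+1 ^ 5 * 3 ^ k) <= 2 ^ 14 * n.+1 ^ 25.
  by rewrite leq_mul2l -[25]/(5 + 20) expnD leq_mul ?orbT.
suff : 2 ^ 14 * n.+1 ^ 25 <= 4 ^ 29 * 4 ^ k + n ^ 64.
  move: e100 le25; move: (4 ^ 29 * _) (n ^ 64) (2 ^ 14 * _) (2 ^ 14 * _); clear; lia.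
(* For [n <= 1] the left side is at most [2 ^ 39] and fits into the constant. Otherwise [2 <= n] and
   [n.+1 <= n ^ 2] give the exponent [14 + 2 * 25]. *)
have [n1|n2] := leqP n 1.
  apply: leq_trans (leq_addr _ _); apply: (small 20) => //; rewrite -(e2 20).
  rewrite -[20.*2]/(14 + 26) expnD leq_mul // (@leq_trans (2 ^ 25)) ?leq_pexp2l // leq_exp2r //.
apply: leq_trans (leq_addl _ _).
rewrite -[64]/(14 + 2 * 25) expnD expnM leq_mul // leq_exp2r //.
by rewrite -mulnn; nia.
Qed.

(** * The main program: trying all start vertices *)

Section MainProgram.
Variable G : sgraph.
Implicit Types R : {set G}.

Definition search_from k (x : G) : option (seq {set G}) :=
  search #|G|.*2.+1 ([set: G] :\ x) [set x] set0 k.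

Lemma state_ok_start (x : G) : state_ok ([set: G] :\ x) [set x] set0.
Proof.
apply/and5P; split; rewrite ?sub0set //.
- by apply/set0Pn; exists x; rewrite inE.
- by rewrite disjoints_subset setDE subsetIr.
- by rewrite disjoint_sym disjoints_subset sub0set.
- by rewrite disjoint_sym disjoints_subset sub0set.
Qed.

Lemma search_from_sound k x s :
  search_from k x = Some s -> bag_path [set: G] s /\ #|G| <= k + size s.
Proof.
move=> E; have [bp _ _] := search_sound (state_ok_start x) E.
rewrite eqxx addn0 addn1 => le; split.
  by move: bp; rewrite setU0 setUC setD1K.
by rewrite -cardsT (cardsD1 x) inE.
Qed.

(** Any vertex of the first bag of a solution is a good start. *)
Lemma search_from_complete k :
  contractible_to_path k G -> exists x, search_from k x.
Proof.
case/contractible_bag_path=> [[|W s] [bp // _ le]].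
have [/andP[/set0Pn[x xW] _] _ _ _ _] := bp; exists x.
have cardU : #|[set: G] :\ x| = #|G|.-1.
  by rewrite -cardsT [in RHS](cardsD1 x) inE.
have G0 : 0 < #|G| by rewrite (cardD1 x) inE.
apply: (search_complete (state_ok_start x) (s := W :: s)).
  split; rewrite ?sub0set ?sub1set //.
    by rewrite setU0 setUC setD1K.
  by move: le; rewrite cardU eqxx; move: G0; clear; lia.
by rewrite cardU eqxx; move: G0; clear; lia.
Qed.

Definition try_cost k : nat := 2 * (step_cost G * #|G|.*2.+1 * 3 ^ k) + step_cost G.

(** [R] holds the start vertices still to be tried; the extra unit in [#|R|.+1] pays for finding [R]
    empty. *)
Lemma call_try_all R k : exists r T,
  [/\ call 8 (Node (vset_tree R) (Node (graph_tree G)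
               (Node (vset_tree [set: G]) (unary_tree k)))) (answer r) T,
      T <= #|R|.+1 * try_cost k,
      forall s, r = Some s -> exists x, search_from k x = Some s
    & r = None -> {in R, forall x, search_from k x = None}].
Proof.
elim: {R}_.+1 {-2}R (ltnSn #|R|) => // n IHn R; rewrite ltnS => leR.
have costS : #|R|.+1 * try_cost k = try_cost k + #|R| * try_cost k by rewrite mulSn.
have [R0|nR] := boolP (R == set0).
  exists None, (step_cost G); split=> //.
  - by run with (set_call); last within_step_cost.
  - by rewrite costS /try_cost; move: (_ * 3 ^ k) (#|R| * _); clear; lia.
  - by move=> _ x; rewrite (eqP R0) inE.
have [x xR lowR] := lowP nR.
have [|T1 [call1 le1 _]] := @call_search G #|G|.*2.+1 ([set: G] :\: low R) (low R) set0 k.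
  by rewrite eqxx addn0 ltnS leq_double -cardsT subset_leq_card ?subsetDl.
rewrite lowR -/(search_from k x) in call1; rewrite /search_arg in call1.
case E: (search_from k x) call1 => [s|]; rewrite /= /answer_yes /answer_no => call1.
  exists (Some s), (step_cost G + T1); split=> //.
  - run with (rewrite ?lowR; set_call); first done; within_step_cost.
  - by rewrite costS /try_cost; move: le1; move: (_ * 3 ^ k) (#|R| * _); clear; lia.
  - by move=> s' [<-]; exists x.
have [|r [T2 [call2 le2 some none]]] := IHn (R :\ x).
  by move: leR; rewrite (cardsD1 x R) xR.
exists r, (step_cost G + T1 + T2); split=> //.
- by run with (rewrite ?lowR; set_call); last within_step_cost.
- rewrite costS; move: le2; rewrite (cardsD1 x R) xR /= add1n.
  rewrite {2}/try_cost; move: le1; move: (_ * 3 ^ k) (#|R :\ x|.+1 * _); clear; lia.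
- move=> rN y yR; have [-> //|nyx] := eqVneq y x.
  by apply: none; rewrite // !inE nyx.
Qed.

Lemma call_full : call 9 (graph_tree G) (vset_tree [set: G]) (20 * gcost G 1).
Proof.
rewrite graph_treeE vset_treeE; eapply call_le; first exact: call_ones.
  rewrite /matrix !size_map -enumT; congr (bits _).
  by rewrite /sbits; elim: (enum G) => //= x s ->; rewrite inE.
by rewrite /matrix !size_map -enumT -cardE gcost1.
Qed.

Lemma call_main k : exists r T,
  [/\ call 0 (instance_tree G k) (answer r) T,
      T <= 2 ^ 14 * (#|G|.+1 ^ 5 * 3 ^ k) + 100 * 4 ^ k,
      forall s, r = Some s -> [/\ 0 < #|G|, bag_path [set: G] s & #|G| <= k + size s]
    & r = None -> ~ contractible_to_path k G].
Proof.
have [r [T1 [call1 le1 some none]]] := call_try_all [set: G] k.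
have [b bE [bv bs]] := nat_tree_bits k.
have callk := call_unary b; rewrite -bE bv in callk.
have callF := call_full.
exists r, (T1 + 50 * (size b).+1 * k.+1 + 20 * gcost G 1 + 20); split.
- rewrite /instance_tree.
  by run with (eassumption); last by (clear; lia).
- rewrite cardsT in le1.
  have h1 := @main_cost_le #|G| (3 ^ k) (step_cost G).
  have {h1} := h1 (_ : 0 < 3 ^ k) erefl; rewrite expn_gt0 => /(_ isT).
  rewrite -/(try_cost k) gcost1; have := unary_cost_le k.
  have : 50 * (size b).+1 * k.+1 <= 50 * k.+2 * k.+1 by rewrite !leq_mul.
  rewrite gcost1 in le1; move: le1.
  move: (gcost G 1 * _) (2 ^ 14 * _) (_ * 4 ^ k) (_ * k.+1) (_ * k.+1); clear; lia.
- move=> s /some[x /search_from_sound[bp le]]; split=> //.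
  by rewrite (cardD1 x) inE.
- by move=> rN /search_from_complete[x]; rewrite none ?inE.
Qed.

End MainProgram.

(* The logarithmic term in the exponent and the success probability *)
From mathcomp Require Import all_boot all_order all_algebra.
From mathcomp Require Import all_classical all_reals all_analysis.

Import Order.TTheory GRing.Theory Num.Theory.
Import numFieldNormedType.Exports.

Local Open Scope classical_set_scope.
Local Open Scope ring_scope.

(** [ln n] is at least [1] from [expR 1] on. *)
Lemma cst_bigO_ln (R : realType) (a : R) :
  ((fun=> a) : nat -> R^o) =O_\oo ((fun k => ln k%:R) : nat -> R^o).
Proof.
apply/eqO_exP; exists (`|a| + 1); first by rewrite ltr_wpDl.
near=> n; have le_n : expR 1 <= n%:R :> R by near: n; apply: nbhs_infty_ger.
have n0 : 0 < n%:R :> R by apply: lt_le_trans le_n; apply: expR_gt0.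
have ln1 : 1 <= ln n%:R :> R by rewrite -[leLHS]expRK ler_ln ?posrE // expR_gt0.
rewrite -[leLHS]mulr1; apply: ler_pM => //; first by rewrite lerDl.
by apply: le_trans ln1 _; apply: ler_norm.
Unshelve. all: by end_near. Qed.

Theorem theorem2 (R : realType) :
  exists (P : program) (f : nat -> R) (c : nat),
    (f : nat -> R^o) =O_\oo ((fun k => ln k%:R) : nat -> R^o) /\
    forall (G : sgraph) (k : nat),
      exists m : nat,
        (forall w : m.-tuple bool,
           exists (v : tree) (t : nat),
             [/\ runs P (instance_tree G k) w v t,
                 t%:R <= 4 `^ (k%:R + f k) + #|G|%:R ^+ c,
                 v = answer_no \/
                   exists (l : nat) (W : l.-tuple {set G}),
                     [/\ v = answer_yes W, path_witness W & (#|G| - k <= l)%N]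
               & ~ contractible_to_path k G -> v = answer_no])
        /\
        (contractible_to_path k G ->
           1 - (expR 1)^-1 <=
           coin_prob R (fun w : m.-tuple bool =>
             exists (v : tree) (t : nat),
               runs P (instance_tree G k) w v t /\ is_yes v)).
Proof.
(* Both constants are those of [exp3_tradeoff]. *)
exists path_program, (fun=> 30%:R), 64; split; first exact: cst_bigO_ln.
move=> G k; exists 0.
have [r [T [[t le_t evt] le_T some none]]] := call_main G k.
have run_t (w : 0.-tuple bool) : runs path_program (instance_tree G k) w (answer r) t.
  by exists w; apply: evt.
split=> [w|ctr].
  exists (answer r), t; split.
  - exact: run_t.
  (* The exponent [k + 30] is a natural number, so the bound becomes an inequality in [nat]. *)
  - rewrite -natrD powR_mulrn // -!natrX -natrD ler_nat.
    exact: leq_trans (leq_trans le_t le_T) (exp3_tradeoff _ _).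
  - case: r some {none evt run_t} => [s|] some; last by left.
    have [_ bp le] := some s erefl; right; exists (size s), (in_tuple s); split=> //.
      exact: bag_path_witness.
    by rewrite leq_subLR.
  - case: r some {none evt run_t} => [s|] some nctr //.
    have [G0 bp le] := some s erefl.
    by case: nctr; apply: bag_path_contractible G0 bp le.
have [s rE] : exists s, r = Some s.
  by case: r none {some evt run_t} => [s|none]; [exists s | case: (none erefl)].
(* With [m = 0] the empty toss vector is the only one, and it is accepted: the probability is
   [1]. *)
rewrite /coin_prob expr0 divr1 (_ : [set w | _] = [set: 0.-tuple bool])%SET; last first.
  apply/setP=> w; rewrite !finset.inE; apply/asboolP; exists (answer r), t.
  by split; [exact: run_t | rewrite rE].
by rewrite cardsT card_tuple expn0 lerBlDr lerDl invr_ge0 expR_ge0.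
Qed.
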